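(* For all $k\geq 1$ there exist $C_1,C_2>0$ such that the following holds. Suppose $\mathcal{H}$ is a hereditary $3$-graph property such that $k\otimes U(k)\notin\text{Trip}(\mathcal{H})$ and $\mathcal{H}$ is far from finite VC-dimension. Then $2^{\epsilon^{-C_1}}\leq M_{\mathcal{H}}(\epsilon)\leq M^{hom}_{\mathcal{H}}(\epsilon^4/2)\leq 2^{2^{\epsilon^{-C_2}}}$ for all sufficiently small $\epsilon>0$.
   Context: $3$-graphs $H=(V,E)$, $E\subseteq\binom V3$; hereditary $3$-graph properties are classes of finite $3$-graphs closed under isomorphism and induced sub-$3$-graphs. $d_H(X,Y,Z)=|\{(x,y,z)\in X\times Y\times Z:\{x,y,z\}\in E\}|/(|X||Y||Z|)$. A triple $(X,Y,Z)$ is $\epsilon$-regular if $|d_H(X,Y,Z)-d_H(X',Y',Z')|\le\epsilon$ for all $X'\subseteq X,Y'\subseteq Y,Z'\subseteq Z$ of sizes at least $\epsilon|X|,\epsilon|Y|,\epsilon|Z|$; $\epsilon$-homogeneous if $d_H(X,Y,Z)\in[0,\epsilon)\cup(1-\epsilon,1]$. A partition $\mathcal P$ of $V$ is $\epsilon$-regular (resp. $\epsilon$-homogeneous) if at least $(1-\epsilon)|V|^3$ triples of $V^3$ lie in some $X\times Y\times Z$ with $(X,Y,Z)\in\mathcal P^3$ $\epsilon$-regular (resp. $\epsilon$-homogeneous). $M_{\mathcal H}(\epsilon)$ (resp. $M^{hom}_{\mathcal H}(\epsilon)$) is the least $M$ such that all sufficiently large members of $\mathcal H$ have an $\epsilon$-regular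 (resp. $\epsilon$-homogeneous) partition with at most $M$ parts. $\text{Trip}(H)$ has vertices $x_v,y_v,z_v$ ($v\in V$) and edges $x_vy_{v'}z_{v''}$ for $vv'v''\in E$; $\text{Trip}(\mathcal H)$ is the closure of $\{\text{Trip}(H)\}$ under isomorphism and induced sub-$3$-graphs. $U(k)$: bipartite with parts $\{a_1,..,a_k\}$, $\{b_S:S\subseteq[k]\}$, edges $a_ib_S$ for $i\in S$; $n\otimes G$ for bipartite $G=(U\cup V,E)$ is the $3$-graph on $U\cup V\cup\{c_1,..,c_n\}$ with edges $\{c_i,u,w\}$, $uw\in E$. The VC-dimension of a $3$-graph $H$ is the largest $k$ for which there are vertices $a_1,b_1,\dots,a_k,b_k$ and $c_S$ ($S\subseteq[k]$) with $a_ib_ic_S\in E$ iff $i\in S$; $\textnormal{VC}(\mathcal H)=\sup_{H\in\mathcal H}\textnormal{VC}(H)$. Two $3$-graphs $H=(V,E)$, $H'=(V,E')$ on the same vertex set are $\delta$-close if the ordered edge sets satisfy $|\overline E\Delta\overline{E'}|\le\delta|V|^3$, where $\overline E=\{(x,y,z):xyz\in E\}$. $\mathcal H$ is close to $\mathcal H'$ if for every $\delta>0$ there is $N$ such that every $H\in\mathcal H$ with at least $N$ vertices is $\delta$-close to some $H'\in\mathcal H'$ on the same vertex set. $\mathcal H$ is far from finite VC-dimension if there is no hereditary $\mathcal H'$ with $\textnormal{VC}(\mathcal H')<\infty$ to which $\mathcal H$ is close. *)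

(* Defs.v *)
From Stdlib Require Import Reals.
From mathcomp Require Import all_boot.
Set Implicit Arguments. Unset Strict Implicit. Unset Printing Implicit Defensive.

Definition is3graph (T : finType) (E : {set {set T}}) : Prop :=
  forall e, e \in E -> #|e| = 3.

(* A class of finite 3-graphs, represented by its members on the canonical
   vertex sets 'I_n (every finite 3-graph is isomorphic to one of these). *)
Definition prop3 := forall n : nat, {set {set 'I_n}} -> Prop.

Definition induced (T1 T2 : finType) (f : T1 -> T2) (E2 : {set {set T2}})
  : {set {set T1}} := [set S : {set T1} | f @: S \in E2].

(* Hereditary: a class of 3-graphs closed under isomorphism and induced
   sub-3-graphs (both are pullbacks along injections 'I_m -> 'I_n). *)
Definition hereditary (P : prop3) : Prop :=
  (forall n E, P n E -> is3graph E) /\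
  (forall m n (f : 'I_m -> 'I_n) E, injective f -> P n E -> P m (induced f E)).

Definition embeds (T1 T2 : finType) (E1 : {set {set T1}}) (E2 : {set {set T2}})
  : Prop :=
  exists f : T1 -> T2, injective f /\ forall S : {set T1}, (S \in E1) = (f @: S \in E2).

Definition triples (T : finType) (E : {set {set T}}) (X Y Z : {set T})
  : {set T * T * T} :=
  [set t : T * T * T | [&& t.1.1 \in X, t.1.2 \in Y, t.2 \in Z &
                          [set t.1.1; t.1.2; t.2] \in E]].

Definition oedges (T : finType) (E : {set {set T}}) : {set T * T * T} :=
  triples E [set: T] [set: T] [set: T].

(* Trip(H): vertices x_v = v, y_v = n+v, z_v = 2n+v of 'I_(n+n+n). *)
Definition trip (n : nat) (E : {set {set 'I_n}}) : {set {set 'I_(n + n + n)}} :=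
  [set S | [exists v : 'I_n, exists v' : 'I_n, exists v'' : 'I_n,
     ([set v; v'; v''] \in E) &&
     (S == [set lshift n (lshift n v); lshift n (rshift n v'); rshift (n + n) v''])]].

Definition in_Trip (P : prop3) (T : finType) (E : {set {set T}}) : Prop :=
  exists n (E0 : {set {set 'I_n}}), P n E0 /\ embeds E (trip E0).

(* k (x) U(k): vertices a_j = inl (inl j), b_A = inl (inr A) (A subset of [k]),
   c_i = inr i; edges {c_i, a_j, b_A} for j in A. *)
Definition kU_vert (k : nat) : finType := ('I_k + {set 'I_k} + 'I_k)%type.
Definition kUk (k : nat) : {set {set kU_vert k}} :=
  [set S | [exists i : 'I_k, exists j : 'I_k, exists A : {set 'I_k},
     (j \in A) && (S == [set (inr i : kU_vert k); inl (inl j); inl (inr A)])]].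

Definition VC_ge (T : finType) (E : {set {set T}}) (k : nat) : Prop :=
  exists (a b : 'I_k -> T) (c : {set 'I_k} -> T),
    forall (i : 'I_k) (S : {set 'I_k}), ([set a i; b i; c S] \in E) = (i \in S).

Definition finite_VC (P : prop3) : Prop :=
  exists K : nat, forall n (E : {set {set 'I_n}}) k, P n E -> VC_ge E k -> (k <= K)%N.

Open Scope R_scope.

Definition density (T : finType) (E : {set {set T}}) (X Y Z : {set T}) : R :=
  INR #|triples E X Y Z| / INR (#|X| * #|Y| * #|Z|)%N.

Definition close_to (P P' : prop3) : Prop :=
  forall delta : R, 0 < delta -> exists N : nat,
    forall n (E : {set {set 'I_n}}), P n E -> (N <= n)%N ->
      exists E' : {set {set 'I_n}}, P' n E' /\
        INR #|(oedges E :\: oedges E') :|: (oedges E' :\: oedges E)|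
          <= delta * INR (n ^ 3)%N.

Definition far_from_finite_VC (P : prop3) : Prop :=
  ~ (exists P' : prop3, hereditary P' /\ finite_VC P' /\ close_to P P').

Definition reg_triple (T : finType) (E : {set {set T}}) (eps : R)
  (X Y Z : {set T}) : Prop :=
  forall X' Y' Z' : {set T}, X' \subset X -> Y' \subset Y -> Z' \subset Z ->
    eps * INR #|X| <= INR #|X'| -> eps * INR #|Y| <= INR #|Y'| ->
    eps * INR #|Z| <= INR #|Z'| ->
    Rabs (density E X Y Z - density E X' Y' Z') <= eps.

Definition hom_triple (T : finType) (E : {set {set T}}) (eps : R)
  (X Y Z : {set T}) : Prop :=
  (0 <= density E X Y Z < eps) \/ (1 - eps < density E X Y Z <= 1).

Definition good_partition (T : finType)
  (Q : {set T} -> {set T} -> {set T} -> Prop) (eps : R) (Pt : {set {set T}}) : Prop :=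
  partition Pt [set: T] /\
  exists S : {set T * T * T},
    (1 - eps) * INR (#|T| ^ 3)%N <= INR #|S| /\
    forall t, t \in S -> exists X Y Z : {set T},
      [/\ X \in Pt, Y \in Pt & Z \in Pt] /\
      [/\ t.1.1 \in X, t.1.2 \in Y & t.2 \in Z] /\ Q X Y Z.

Definition reg_partition (T : finType) (E : {set {set T}}) (eps : R) Pt :=
  good_partition (reg_triple E eps) eps Pt.
Definition hom_partition (T : finType) (E : {set {set T}}) (eps : R) Pt :=
  good_partition (hom_triple E eps) eps Pt.

Definition M_reg_ok (P : prop3) (eps : R) (M : nat) : Prop :=
  exists N : nat, forall n (E : {set {set 'I_n}}), P n E -> (N <= n)%N ->
    exists Pt : {set {set 'I_n}}, (#|Pt| <= M)%N /\ reg_partition E eps Pt.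
Definition M_hom_ok (P : prop3) (eps : R) (M : nat) : Prop :=
  exists N : nat, forall n (E : {set {set 'I_n}}), P n E -> (N <= n)%N ->
    exists Pt : {set {set 'I_n}}, (#|Pt| <= M)%N /\ hom_partition E eps Pt.

Definition is_least (Q : nat -> Prop) (m : nat) : Prop :=
  Q m /\ forall m', Q m' -> (m <= m')%N.

(* Main.v *)
(* Upper bound.  For all but boundedly many vertices c the link of c contains few copies of
   U(k), so by Sauer-Shelah a random sample of polynomially many points is an approximate net
   for it.  Sample y_1, ..., y_p that are a net for most links, then z_1, ..., z_q that are a net
   for the links of all the y_i.  Two typical vertices x, x' which agree on all triples
   (x, y_i, z_j) then have almost the same link, so these 2^(pq) types give a homogeneous
   partition, whose number of parts is even only exponential in a power of 1/eps.

   Lower bound.  If no member of H contained a large blow-up of the configuration a_i, b_i, c_S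
   (i < m, S a subset of m), then choosing a random representative in each part of the above
   partition would bring every large member of H close to the pullback of a 3-graph of bounded
   VC-dimension: otherwise a positive proportion of the systems of representatives would span
   one and the same 3-graph of large VC-dimension, and a box of such systems is a blow-up.  So H
   contains all such blow-ups.  In a blow-up with m of order 1/eps, a partition with fewer than
   2^(m/2 - 2) parts leaves half of the codes S in parts that are balanced in half of the
   coordinates i, and every triple of A_i x B_i x C_S for such a pair (S, i), up to few
   exceptions, lies in an irregular triple of parts. *)
Require Import Defs.
From Stdlib Require Import Reals Lra Classical.
From mathcomp Require Import all_boot zify.
Set Implicit Arguments. Unset Strict Implicit. Unset Printing Implicit Defensive.
Local Open Scope nat_scope.

(** * The Sauer-Shelah lemma *)

(** A net for the link of c controls x only through the values e(x, y_i, c), which still depend on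
    c. For fixed i and varying c they form the neighbourhood of x in the link of y_i, so a second
    net, for the links of the y_i, recovers them for most c from the bits e(x, y_i, z_j).

    At precision 1/u a sample has u^2 points. For a final precision 1/v the y-sample is taken with u
    = v^2, one factor v being lost in passing from most pairs (x, c) to most x, and the z-sample
    with u' = v^5, because the errors of v^4 links add up. A label thus has v^4 * v^10 = v^14 bits.

    The 3-graph on the labels has to be spanned by actual vertices, since only then does its large
    VC-dimension produce configurations in the member itself. Closeness of links bounds the effect
    of replacing one vertex in a triple of typical vertices, but not in a given triple that already
    contains representatives; hence the representatives are random and the error is bounded on
    average. *)

Section Sauer.
Variable T : finType.
Implicit Types (F : {set {set T}}) (S B A : {set T}).

Definition shatters F S : bool :=
  [forall B : {set T}, (B \subset S) ==> [exists A in F, A :&: S == B]].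

Lemma shattersP F S :
  reflect (forall B, B \subset S -> exists2 A, A \in F & A :&: S = B) (shatters F S).
Proof.
apply: (iffP forallP) => [h B sBS|h B].
  by have /implyP/(_ sBS)/existsP[A /andP[AF /eqP]] := h B; exists A.
by apply/implyP => /h[A AF AS]; apply/existsP; exists A; rewrite AF AS eqxx.
Qed.

Lemma shattersS F1 F2 S : F1 \subset F2 -> shatters F1 S -> shatters F2 S.
Proof.
move=> /subsetP sF /shattersP h; apply/shattersP => B /h[A AF <-].
by exists A => //; apply: sF.
Qed.

(* Pajor's strengthening of the Sauer-Shelah lemma. *)
Lemma card_shattered F : #|F| <= #|[set S | shatters F S]|.
Proof.
have [m] := ubnP #|F|; elim: m F => // m IH F; rewrite ltnS => leFm.
have [/set0Pn[A0 A0F]|/negbNE/eqP->] := boolP (F != set0); last by rewrite cards0.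
have [F1|F1] := leqP #|F| 1.
  apply: (leq_trans F1); apply/card_gt0P; exists set0; rewrite inE.
  by apply/shattersP => B; rewrite subset0 => /eqP->; exists A0; rewrite ?setI0.
have [A1 A1F [x xD]] : exists2 A1, A1 \in F & exists x, (x \in A0) != (x \in A1).
  move: F1; rewrite (cardD1 A0) A0F add1n ltnS => /card_gt0P[A1].
  rewrite !inE => /andP[A10 A1F]; exists A1 => //.
  apply/existsP; rewrite -negb_forall; apply: contra A10 => /forallP h.
  by apply/eqP/setP => x; have /eqP-> := h x.
pose Fx b := [set A in F | (x \in A) == b].
have FxF b : Fx b \subset F by apply/subsetP => A; rewrite inE => /andP[].
have Flt b : #|Fx b| < #|F|.
  apply: proper_card; apply/properP; split=> //.
  have [->|nb] := eqVneq b (x \in A0).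
    by exists A1 => //; rewrite inE A1F /= eq_sym.
  by exists A0 => //; rewrite inE A0F /= eq_sym.
have IHb b : #|Fx b| <= #|[set S | shatters (Fx b) S]|.
  by apply: IH; apply: leq_trans (Flt b) leFm.
have FxN b S : shatters (Fx b) S -> x \notin S.
  move=> /shattersP h; apply/negP => xS.
  have [A] := h (if b then set0 else S) ltac:(by case: (b); rewrite ?sub0set).
  rewrite inE => /andP[_ /eqP xA] /setP/(_ x).
  by rewrite !inE xS xA; case: (b); rewrite ?inE ?xS.
have -> : #|F| = #|Fx true| + #|Fx false|.
  rewrite -(cardsID [set A : {set T} | x \in A] F); congr (_ + _); apply: eq_card => A;
    by rewrite !inE //; case: (A \in F); case: (x \in A).
apply: leq_trans (leq_add (IHb true) (IHb false)) _.
rewrite -cardsUI.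
set U := _ :|: _; set I := _ :&: _.
(* A set shattered by both halves is counted twice; its second count goes to the set with [x] added,
   which the whole family shatters. *)
have <- : #|[set x |: S | S in I]| = #|I|.
  apply: card_in_imset => S1 S2; rewrite !inE => /andP[/FxN n1 _] /andP[/FxN n2 _] e.
  by rewrite -(setU1K n1) e setU1K.
rewrite -cardsUI [X in _ + X]eq_card0 ?addn0; last first.
  move=> S; rewrite !inE; apply/negP => /andP[h /imsetP[S' _ eS]].
  have : x \notin S by case/orP: h => /FxN.
  by rewrite eS !inE eqxx.
apply: subset_leq_card; apply/subsetP => S; rewrite !inE.
case/orP => [/orP[] /shattersS-> //|/imsetP[S' ]].
rewrite !inE => /andP[h1 h0] ->; apply/shattersP => B sB.
have xS' := FxN _ _ h1.
pose b := x \in B.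
have /shattersP hb : shatters (Fx b) S' by case: (b).
have [A] := hb (B :\ x) ltac:(by rewrite subDset).
rewrite inE => /andP[AF /eqP xA] /setP eA; exists A => //.
apply/setP => y; have := eA y; rewrite !inE.
by have [->|_] := eqVneq y x => //=; rewrite xA andbT.
Qed.

(** Listing the elements and padding with [None] encodes such a set by a map from ['I_k] to
    [option T]. *)
Lemma card_small_sets k : #|[set S : {set T} | #|S| < k]| <= #|T|.+1 ^ k.
Proof.
pose img (f : {ffun 'I_k -> option T}) := [set x | [exists i, f i == Some x]].
apply: leq_trans (_ : #|[set img f | f in [set: {ffun 'I_k -> option T}]]| <= _).
  apply: subset_leq_card; apply/subsetP => S; rewrite inE => Sk.
  apply/imsetP; exists [ffun i : 'I_k => nth None (map Some (enum S)) i] => //.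
  apply/setP => x; rewrite inE; apply/idP/existsP => [xS|[i]].
    have lt : index x (enum S) < #|S| by rewrite cardE index_mem mem_enum.
    exists (Ordinal (ltn_trans lt Sk)); rewrite ffunE /=.
    by rewrite (nth_map x) -?cardE // nth_index ?mem_enum.
  rewrite ffunE => /eqP e.
  have lt : i < size (enum S).
    by rewrite ltnNge; apply/negP => ge; rewrite nth_default ?size_map in e.
  by move: e; rewrite (nth_map x) // => -[<-]; rewrite -mem_enum mem_nth.
apply: leq_trans (leq_imset_card _ _) _.
by rewrite cardsT card_ffun card_option card_ord.
Qed.

(** By [card_shattered] there are more shattered sets than sets with fewer than [k] elements, so
    some shattered set has at least [k] elements; [a] lists [k] of them. *)
Lemma sauer_shelah F k : #|T|.+1 ^ k < #|F| ->
  exists a : {ffun 'I_k -> T}, injective a /\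
    forall S : {set 'I_k}, exists2 A, A \in F & forall j, (a j \in A) = (j \in S).
Proof.
move=> lt; have [S shS kS] : exists2 S, shatters F S & k <= #|S|.
  apply/exists_inP; rewrite -[X in is_true X]negbK negb_exists_in.
  apply/negP => /forall_inP h; move: lt; rewrite ltnNge => /negP; apply.
  apply: leq_trans (card_shattered F) _; apply: leq_trans (card_small_sets k).
  by apply: subset_leq_card; apply/subsetP => S; rewrite !inE => /h; rewrite ltnNge.
pose a := [ffun j : 'I_k => enum_val (widen_ord kS j)].
have aI : injective a.
  by move=> i j; rewrite !ffunE => /enum_val_inj/(congr1 val)/= /val_inj.
have aS j : a j \in S by rewrite ffunE enum_valP.
exists a; split=> // S'.
have [A AF /setP AS] := shattersP _ _ shS (a @: S') ltac:(
  by apply/subsetP => _ /imsetP[j _ ->]).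
exists A => // j; have := AS (a j); rewrite inE (mem_imset _ _ aI) => <-.
by rewrite aS andbT.
Qed.

End Sauer.

(** * Random samples as approximate nets *)

Lemma card_sum_bool (T : finType) (P : pred T) : #|[set x | P x]| = \sum_x (P x : nat).
Proof. by rewrite -sum1dep_card big_mkcond; apply: eq_bigr => x _; case: (P x). Qed.

Lemma double_count (T U : finType) (R : T -> U -> bool) :
  \sum_x #|[set y | R x y]| = \sum_y #|[set x | R x y]|.
Proof.
under eq_bigr do rewrite card_sum_bool.
by rewrite exchange_big; apply: eq_bigr => y _; rewrite card_sum_bool.
Qed.

Lemma card_pairs (T U : finType) (R : T -> U -> bool) :
  #|[set p : T * U | R p.1 p.2]| = \sum_x #|[set y | R x y]|.
Proof.
rewrite card_sum_bool -(pair_big xpredT xpredT (fun x y => (R x y : nat))) /=.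
by apply: eq_bigr => x _; rewrite card_sum_bool.
Qed.

Lemma markov (T : finType) (f : T -> nat) (A : {set T}) c :
  (forall x, x \in A -> c <= f x) -> #|A| * c <= \sum_x f x.
Proof.
move=> h; rewrite -sum_nat_const [X in _ <= X](bigID (mem A)) /=.
by apply: leq_trans (leq_addr _ _); apply: leq_sum => x /h.
Qed.

Lemma sum_bounded (T : finType) (f : T -> nat) c : (forall x, f x <= c) -> \sum_x f x <= #|T| * c.
Proof. by move=> h; rewrite -sum_nat_const; apply: leq_sum. Qed.

Lemma card_set_type (T : finType) : #|{: {set T}}| = 2 ^ #|T|.
Proof. by rewrite -(cardsT T) -card_powerset powersetT cardsT. Qed.

Lemma card_family_prod (T U : finType) (F : T -> {set U}) :
  #|family (fun x => F x)| = \prod_x #|F x|.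
Proof. by rewrite card_family foldrE big_image. Qed.

(** This is (1 - 1/u)^u <= 1/2, obtained from Bernoulli's inequality (1 + 1/w)^j >= 1 + j/w with
    denominators cleared. *)
Lemma pred_exp_half u : 0 < u -> 2 * u.-1 ^ u <= u ^ u.
Proof.
case: u => // w _ /=.
have h j : w ^ j * (w + j) <= w * w.+1 ^ j.
  elim: j => [|j IH]; first by rewrite addn0 mul1n muln1.
  have h2 : w ^ j <= w.+1 ^ j by case: (j) => // j'; rewrite leq_exp2r.
  by rewrite !expnS; nia.
case: w h => [|w] h; first by rewrite exp1n.
rewrite -(leq_pmul2l (ltn0Sn w)); apply: leq_trans (h w.+2).
have := leq0n (w.+1 ^ w.+2); nia.
Qed.

Section Net.
Variables (V : finType) (L : V -> V -> bool).
Local Notation n := #|V|.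

Definition pattern m (z : {ffun 'I_m -> V}) x : {set 'I_m} := [set i | L x (z i)].
Definition diff x x' : {set V} := [set y | L x y != L x' y].
Definition far u x x' := n < u * #|diff x x'|.
Definition same_pattern m (z : {ffun 'I_m -> V}) x : {set V} :=
  [set x' | pattern z x' == pattern z x].
Definition conflicts m u (z : {ffun 'I_m -> V}) x : {set V} :=
  [set x' | (pattern z x' == pattern z x) && far u x x'].

(** The tuples span a copy of U(k) in the bipartite graph of [L]; points of [a] may coincide with
    points of [b]. *)
Definition shatter k (a : {ffun 'I_k -> V}) (b : {ffun {set 'I_k} -> V}) : bool :=
  [forall j, forall S, L (b S) (a j) == (j \in S)].
Definition shatter_count k :=
  \sum_(a : {ffun 'I_k -> V}) #|[set b | shatter a b]|.

Definition is_net m u (z : {ffun 'I_m -> V}) : bool :=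
  [exists Exc : {set V}, (u * #|Exc| <= n) &&
    [forall x, forall x', (x \notin Exc) ==> (x' \notin Exc) ==>
       (pattern z x == pattern z x') ==> (u * #|diff x x'| <= 2 * n)]].

Lemma diff_sym x x' : diff x x' = diff x' x.
Proof. by apply/setP => y; rewrite !inE eq_sym. Qed.

Lemma diff_triangle x y z : #|diff x z| <= #|diff x y| + #|diff y z|.
Proof.
apply: leq_trans (subset_leq_card _) (leq_card_setU (diff x y) (diff y z)).
by apply/subsetP => w; rewrite !inE; case: (L x w); case: (L y w); case: (L z w).
Qed.

(** Each sample point misses [diff x x'] with probability at most 1 - 1/u, so all u^2 of them do
    with probability at most 2^-u. This is why samples have u^2 points. *)
Lemma far_pattern_count u x x' : 0 < u -> far u x x' ->
  2 ^ u * #|[set z : {ffun 'I_(u * u) -> V} | pattern z x' == pattern z x]| <= n ^ (u * u).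
Proof.
move=> u0 fxx; set Z := [set z | _].
pose c := #|~: diff x x'|.
have cn : u * c <= u.-1 * n.
  have := cardsC (diff x x'); rewrite -/c; move: fxx; rewrite /far; nia.
have ZC : #|Z| <= c ^ (u * u).
  rewrite -[X in _ ^ X](card_ord (u * u)) -card_ffun_on; apply: subset_leq_card.
  apply/subsetP => z; rewrite inE => /eqP/setP h; apply/ffun_onP => i.
  by have := h i; rewrite !inE => ->; rewrite eqxx.
apply: leq_trans (leq_mul (leqnn _) ZC) _.
have p0 : 0 < u ^ (u * u) by rewrite expn_gt0 u0.
rewrite -(leq_pmul2l p0) mulnCA -expnMn.
apply: leq_trans (_ : 2 ^ u * (u.-1 * n) ^ (u * u) <= _).
  by rewrite leq_mul2l leq_exp2r ?cn ?orbT // muln_gt0 u0.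
rewrite expnMn mulnA leq_mul2r; apply/orP; right.
by rewrite [u.-1 ^ _]expnM -expnMn [X in _ <= X]expnM leq_exp2r // pred_exp_half.
Qed.

Lemma conflicts_count u : 0 < u ->
  2 ^ u * \sum_(z : {ffun 'I_(u * u) -> V}) \sum_x #|conflicts u z x| <= n * n * n ^ (u * u).
Proof.
move=> u0; rewrite exchange_big big_distrr /= -mulnA; apply: sum_bounded => x.
rewrite double_count big_distrr /=; apply: sum_bounded => x'.
have [f|nf] := boolP (far u x x').
  apply: leq_trans (far_pattern_count u0 f); rewrite leq_mul2l subset_leq_card ?orbT //.
  apply/subsetP => z; by rewrite !inE andbT.
by rewrite [X in _ * X]eq_card0 ?muln0 // => z; rewrite !inE andbF.
Qed.

Definition popular m (z : {ffun 'I_m -> V}) D : {set {set 'I_m}} :=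
  [set B | n <= D * #|[set x | pattern z x == B]|].

Definition precomp m k (z : {ffun 'I_m -> V}) (a : {ffun 'I_k -> 'I_m}) :=
  [ffun j => z (a j)].

(** Sauer-Shelah gives [k] sample positions on which the popular patterns show every trace. Each
    [b S] can then be any of the at least n/D points whose pattern is the chosen one with trace
    [S]. *)
Lemma popular_shatter m k D (z : {ffun 'I_m -> V}) : m.+1 ^ k < #|popular z D| ->
  exists2 a : {ffun 'I_k -> 'I_m}, injective a &
    n ^ (2 ^ k) <= D ^ (2 ^ k) * #|[set b | shatter (precomp z a) b]|.
Proof.
rewrite -{1}[m]card_ord => /sauer_shelah[a [aI h]]; exists a => //.
pose Ch (S : {set 'I_k}) := odflt set0 [pick A in popular z D | [forall j, (a j \in A) == (j \in S)]].
have ChP S : Ch S \in popular z D /\ forall j, (a j \in Ch S) = (j \in S).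
  rewrite /Ch; case: pickP => [A /andP[AF /forallP e]|no] /=.
    by split=> // j; apply/eqP.
  have [A AF e] := h S; have := no A; rewrite AF /=.
  by move/negbT/negP; case; apply/forallP => j; rewrite e.
pose Fm S := [set x | pattern z x == Ch S].
apply: leq_trans (_ : D ^ (2 ^ k) * #|family (fun S => Fm S)| <= _).
  rewrite card_family_prod.
  have -> : 2 ^ k = #|{: {set 'I_k}}| by rewrite card_set_type card_ord.
  rewrite -!prod_nat_const -big_split /=; apply: leq_prod => S _.
  by have [] := ChP S; rewrite inE.
rewrite leq_mul2l; apply/orP; right; apply: subset_leq_card.
apply/subsetP => b /familyP h'; rewrite inE; apply/forallP => j; apply/forallP => S.
have := h' S; rewrite inE => /eqP e; have [_ /(_ j)] := ChP S.
by rewrite -e inE /precomp ffunE => ->.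
Qed.

Lemma precomp_fiber m k (a : {ffun 'I_k -> 'I_m}) (y : {ffun 'I_k -> V}) : injective a ->
  #|[set z | precomp z a == y]| <= n ^ (m - k).
Proof.
move=> aI; pose Fm i := [set v | [forall j, (a j == i) ==> (v == y j)]].
apply: leq_trans (_ : #|family (fun i => Fm i)| <= _).
  apply: subset_leq_card; apply/subsetP => z; rewrite inE => /eqP e.
  apply/familyP => i; rewrite inE; apply/forallP => j; apply/implyP => /eqP <-.
  by rewrite -e ffunE.
rewrite card_family_prod.
rewrite (bigID (mem (a @: [set: 'I_k]))) /= big1_seq ?mul1n => [|i /andP[/imsetP[j _ ->] _]].
  rewrite -[X in n ^ X](_ : #|~: (a @: [set: 'I_k])| = _); last first.
    have := cardsC (a @: [set: 'I_k]); rewrite card_imset // cardsT !card_ord; lia.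
  rewrite -prod_nat_const; under [X in _ <= X]eq_bigl do rewrite inE.
  by apply: leq_prod => i _; apply: max_card.
rewrite (_ : Fm _ = [set y j]) ?cards1 //; apply/setP => v; rewrite !inE.
apply/forallP/eqP => [/(_ j)|-> j']; first by rewrite eqxx => /eqP.
by apply/implyP => /eqP/aI->.
Qed.

(** Double counting: such a sample carries, at some choice [a] of [k] positions, a tuple with at
    least (n/D)^(2^k) shattering [b]. There are at most m^k choices of [a], and a tuple placed at
    these positions extends to at most n^(m-k) samples. *)
Lemma popular_count m k D : k <= m -> 0 < n ->
  n ^ (2 ^ k) * #|[set z : {ffun 'I_m -> V} | m.+1 ^ k < #|popular z D|]| <=
  m ^ k * D ^ (2 ^ k) * n ^ (m - k) * shatter_count k.
Proof.
move=> km n0.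
pose sh (a : {ffun 'I_k -> 'I_m}) (z : {ffun 'I_m -> V}) :=
  if injectiveb a then D ^ (2 ^ k) * #|[set b | shatter (precomp z a) b]| else 0.
rewrite mulnC; apply: leq_trans (_ : \sum_z \sum_a sh a z <= _).
  apply: markov => z; rewrite inE => /popular_shatter[a aI h].
  rewrite (bigD1 a) //= /sh; have /injectiveP-> := aI.
  exact: leq_trans (leq_addr _ _).
rewrite exchange_big /=.
have -> : m ^ k = #|{ffun 'I_k -> 'I_m}| by rewrite card_ffun !card_ord.
rewrite -!mulnA; apply: sum_bounded => a; rewrite /sh.
case: injectiveP => [aI|_]; last by rewrite sum_nat_const muln0.
rewrite -big_distrr leq_mul2l /=; apply/orP; right.
rewrite (partition_big (fun z => precomp z a) xpredT) //= /shatter_count big_distrr /=.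
apply: leq_sum => y _.
rewrite (eq_bigr (fun _ => #|[set b | shatter y b]|)) => [|z /eqP-> //].
by rewrite sum_nat_cond_const leq_mul2r precomp_fiber ?orbT.
Qed.

Lemma card_by_pattern m (z : {ffun 'I_m -> V}) (P : pred {set 'I_m}) :
  #|[set x | P (pattern z x)]| = \sum_(B | P B) #|[set x | pattern z x == B]|.
Proof.
rewrite -sum1dep_card (partition_big (pattern z) P) //=.
apply: eq_bigr => B PB; rewrite -sum1dep_card; apply: eq_bigl => x.
by case: eqP => [->|]; rewrite ?PB ?andbF.
Qed.

(* The exceptional points are those with a small pattern class or in conflict with half of it;
   two other points with the same pattern are both close to some third one. *)
Lemma few_conflicts_net m k u (z : {ffun 'I_m -> V}) :
  let B := 4 * u * m.+1 ^ k in
  0 < u -> 0 < n -> #|popular z (4 * u * 2 ^ m)| <= m.+1 ^ k ->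
  8 * u * B * \sum_x #|conflicts u z x| <= n * n -> is_net u z.
Proof.
move=> B u0 n0 pop conf.
set D := 4 * u * 2 ^ m in pop.
have B0 : 0 < B by rewrite !muln_gt0 u0 expn_gt0.
(* Two thresholds are needed. Classes below n/D are negligible although there may be 2^m of them;
   classes between n/D and n/B are negligible because at most (m+1)^k are popular. So the bound on
   conflicts only has to beat the polynomial [B], not the exponential [D]. *)
pose c x := #|same_pattern z x|; pose f x := #|conflicts u z x|.
pose E1 := [set x | D * c x < n].
pose E2 := [set x | (n <= D * c x) && (B * c x < n)].
pose E3 := [set x | (n <= B * c x) && (c x <= 2 * f x)].
have h1 : 4 * u * #|E1| <= n.
  have -> : E1 = [set x | D * #|[set x' | pattern z x' == pattern z x]| < n] by [].
  rewrite (card_by_pattern z (fun B' => D * #|[set x' | pattern z x' == B']| < n)).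
  have p0 : 0 < 2 ^ m by rewrite expn_gt0.
  rewrite -(leq_pmul2l p0) mulnA [2 ^ m * (4 * u)]mulnC -/D big_distrr /=.
  rewrite big_mkcond /=; have -> : 2 ^ m = #|{: {set 'I_m}}| by rewrite card_set_type card_ord.
  by apply: sum_bounded => B'; case: ifP => // /ltnW.
have h2 : 4 * u * #|E2| <= n.
  have -> : E2 = [set x | (pattern z x \in popular z D) &&
      (B * #|[set x' | pattern z x' == pattern z x]| < n)].
    by apply/setP => x; rewrite !inE.
  rewrite (card_by_pattern z (fun B' => (B' \in popular z D) &&
      (B * #|[set x' | pattern z x' == B']| < n))).
  have p0 : 0 < m.+1 ^ k by rewrite expn_gt0.
  rewrite -(leq_pmul2l p0) mulnA [m.+1 ^ k * _]mulnC -/B big_distrr /=.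
  apply: leq_trans (_ : \sum_(B' in popular z D) n <= _).
    by rewrite big_mkcondr /=; apply: leq_sum => B' _; case: ifP => // /ltnW.
  by rewrite sum_nat_const leq_mul2r pop orbT.
have h3 : 4 * u * #|E3| <= n.
  have : #|E3| * n <= \sum_x 2 * B * f x.
    apply: markov => x; rewrite inE => /andP[]; nia.
  rewrite -big_distrr /= -/f; move: conf; rewrite -/f; set s := \sum_x _.
  move=> conf e3; rewrite -(leq_pmul2l n0); apply: leq_trans conf.
  have : 4 * u * (#|E3| * n) <= 4 * u * (2 * B * s) by rewrite leq_mul2l e3 orbT.
  lia.
apply/existsP; exists (E1 :|: E2 :|: E3); apply/andP; split.
  have hc := leq_trans (leq_card_setU (E1 :|: E2) E3) (leq_add (leq_card_setU E1 E2) (leqnn _)).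
  have := leq_mul (leqnn u) hc; lia.
have out x : x \notin E1 :|: E2 :|: E3 -> 2 * f x < c x.
  by rewrite !inE; case: leqP; case: leqP; case: leqP => //=; case: leqP.
apply/forallP => x; apply/forallP => x'; apply/implyP => /out cx; apply/implyP => /out cx'.
apply/implyP => /eqP e.
have ec : same_pattern z x = same_pattern z x' by apply/setP => w; rewrite !inE e.
have : ~~ (same_pattern z x \subset conflicts u z x :|: conflicts u z x').
  apply/negP => /subset_leq_card; rewrite leqNgt => /negP; apply.
  apply: leq_ltn_trans (leq_card_setU _ _) _.
  move: cx cx'; rewrite /c -ec /f; lia.
case/subsetPn => w; rewrite !inE => /eqP ew; rewrite ew -e eqxx /= /far negb_or -!leqNgt => /andP[w1 w2].
have := leq_mul (leqnn u) (diff_triangle x w x'); rewrite (diff_sym w x') mulnDr mul2n -addnn => h.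
exact: leq_trans h (leq_add w1 w2).
Qed.

(** A sample can fail through too many popular patterns, which the bound on [shatter_count] makes
    rare, or through too many conflicts, which are rare because 2^u beats a polynomial in u. Each
    event has probability at most 1/(2u). *)
Lemma most_samples_net k u :
  0 < u -> 0 < n -> k <= u * u ->
  2 * u * (8 * u * (4 * u * (u * u).+1 ^ k)) <= 2 ^ u ->
  2 * u * (u * u) ^ k * (4 * u * 2 ^ (u * u)) ^ (2 ^ k) * shatter_count k <= n ^ (k + 2 ^ k) ->
  u * #|[set z : {ffun 'I_(u * u) -> V} | ~~ is_net u z]| <= n ^ (u * u).
Proof.
move=> u0 n0 ku hL hp; set m := u * u; set D := 4 * u * 2 ^ m; set Lam := 8 * u * (4 * u * m.+1 ^ k).
pose Z1 := [set z : {ffun 'I_m -> V} | m.+1 ^ k < #|popular z D|].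
pose Z2 := [set z : {ffun 'I_m -> V} | n * n < Lam * \sum_x #|conflicts u z x|].
have sub : [set z : {ffun 'I_m -> V} | ~~ is_net u z] \subset Z1 :|: Z2.
  apply/subsetP => z; rewrite inE in_setU; apply: contraR; rewrite negb_or !inE -!leqNgt.
  by case/andP; apply: few_conflicts_net.
have h1 : 2 * u * #|Z1| <= n ^ m.
  have m0 : 0 < m ^ k * D ^ (2 ^ k).
    by rewrite muln_gt0 !expn_gt0 !muln_gt0 u0 expn_gt0.
  have q0 : 0 < n ^ (2 ^ k) by rewrite expn_gt0 n0.
  rewrite -(leq_pmul2l m0) -(leq_pmul2l q0).
  have := popular_count D ku n0; rewrite -/m -/Z1 => h.
  have e : n ^ m * n ^ (2 ^ k) = n ^ (m - k) * n ^ (k + 2 ^ k).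
    by rewrite -!expnD; congr (_ ^ _); rewrite addnA subnK.
  move: hp h e; rewrite -/m -/D.
  move: (n ^ (2 ^ k)) (n ^ (k + 2 ^ k)) (n ^ m) (n ^ (m - k)) (m ^ k) (D ^ (2 ^ k)) (shatter_count k) (#|Z1|).
  clear; move=> N1 N2 N3 N4 A1 A2 S z1 hp h e.
  have h' : 2 * u * (N1 * z1) <= 2 * u * (A1 * A2 * N4 * S) by rewrite leq_mul2l h orbT.
  have hp' : N4 * (2 * u * A1 * A2 * S) <= N4 * N2 by rewrite leq_mul2l hp orbT.
  have h2 : A1 * A2 * (2 * u * (N1 * z1)) <= A1 * A2 * (N4 * N2).
    rewrite leq_mul2l; apply/orP; right; apply: leq_trans hp'; lia.
  by rewrite -e in h2; lia.
have h2 : 2 * u * #|Z2| <= n ^ m.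
  have := conflicts_count u0; set s := \sum_z _ => cc.
  have : #|Z2| * (n * n) <= \sum_(z : {ffun 'I_m -> V}) Lam * \sum_x #|conflicts u z x|.
    by apply: markov => z; rewrite inE; apply: ltnW.
  rewrite -big_distrr /= -/m -/s => hz.
  have L0 : 0 < Lam by rewrite !muln_gt0 u0 expn_gt0.
  have nn : 0 < n * n by rewrite muln_gt0 n0.
  rewrite -(leq_pmul2l L0) -(leq_pmul2l nn).
  apply: leq_trans (_ : 2 ^ u * (#|Z2| * (n * n)) <= _).
    have : 2 * u * Lam * (#|Z2| * (n * n)) <= 2 ^ u * (#|Z2| * (n * n)) by rewrite leq_mul2r hL orbT.
    by apply: leq_trans; move: (#|Z2|) (n * n) (Lam) => a b c; clear; nia.
  apply: leq_trans (_ : 2 ^ u * (Lam * s) <= _); first by rewrite leq_mul2l hz orbT.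
  by rewrite mulnCA [X in _ <= X]mulnCA leq_mul2l cc orbT.
have h3 := leq_trans (subset_leq_card sub) (leq_card_setU Z1 Z2); move: h1 h2 (leq_mul (leqnn u) h3); rewrite -/m.
move: (#|Z1|) (#|Z2|) (#|_|) (n ^ m) => a b c d; clear; lia.
Qed.

End Net.

(** * Vertex labels from two nested samples *)

Lemma card_coord (V : finType) m (i : 'I_m) (A : {set V}) :
  #|V| * #|[set y : {ffun 'I_m -> V} | y i \in A]| <= #|A| * #|V| ^ m.
Proof.
pose Fm j := if j == i then A else [set: V].
apply: leq_trans (_ : #|V| * #|family (fun j => Fm j)| <= _).
  rewrite leq_mul2l; apply/orP; right; apply: subset_leq_card; apply/subsetP => y.
  rewrite inE => yi; apply/familyP => j; rewrite /Fm.
  by case: eqP => [->|_]; rewrite ?inE.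
rewrite card_family_prod (bigD1 i) //= {1}/Fm eqxx.
rewrite (eq_bigr (fun=> #|V|)) => [|j /negbTE ji]; last by rewrite /Fm ji cardsT.
rewrite prod_nat_const cardC1 card_ord.
by rewrite mulnCA -expnS prednK // (leq_ltn_trans _ (ltn_ord i)).
Qed.

Lemma card_bigcup_le (I T : finType) (F : I -> {set T}) : #|\bigcup_i F i| <= \sum_i #|F i|.
Proof.
elim/big_rec2: _ => [|i s A _ h]; first by rewrite cards0.
exact: leq_trans (leq_card_setU _ _) (leq_add (leqnn _) h).
Qed.

Lemma sum_bounded_ord m (f : 'I_m -> nat) c : (forall i, f i <= c) -> \sum_i f i <= m * c.
Proof. by rewrite -[X in X * c](card_ord m); apply: sum_bounded. Qed.

(** The factor of [shatter_count] in the last condition of [most_samples_net]. It does not depend on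
    the number of vertices, so 1 / [net_level] is a fixed density of copies of U(k) below which most
    samples are nets. *)
Definition net_level k u := 2 * u * (u * u) ^ k * (4 * u * 2 ^ (u * u)) ^ (2 ^ k).

Section Structure.
Variables (V : finType) (e : V -> V -> V -> bool) (k : nat).
Local Notation n := #|V|.
Hypothesis e_sym23 : forall x y z, e x y z = e x z y.

Definition slice c x y := e x y c.

Hypothesis no_kU : forall (a : {ffun 'I_k -> V}) (b : {ffun {set 'I_k} -> V}) (c : 'I_k -> V),
  injective c -> ~ (forall i, shatter (slice (c i)) a b).

(** A pair (a, b) shattered in [k] different slices would be a copy of k (x) U(k), so each pair is
    counted at most [k] times. *)
Lemma sum_shatter_count : \sum_c shatter_count (slice c) k <= k * n ^ (k + 2 ^ k).
Proof.
rewrite exchange_big expnD mulnCA.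
have -> : n ^ k = #|{ffun 'I_k -> V}| by rewrite card_ffun card_ord.
apply: sum_bounded => a; rewrite double_count mulnC.
have -> : n ^ (2 ^ k) = #|{ffun {set 'I_k} -> V}| by rewrite card_ffun card_set_type card_ord.
apply: sum_bounded => b; rewrite leqNgt; apply/negP => /ltnW lt.
apply: (@no_kU a b (fun i => enum_val (widen_ord lt i))).
  by move=> i j /enum_val_inj/(congr1 val)/= /val_inj.
by move=> i; have := enum_valP (widen_ord lt i); rewrite inE.
Qed.

Definition rich_slices u : {set V} :=
  [set c | n ^ (k + 2 ^ k) < net_level k u * shatter_count (slice c) k].

Lemma card_rich_slices u : 0 < n -> #|rich_slices u| <= net_level k u * k.
Proof.
move=> n0; have q0 : 0 < n ^ (k + 2 ^ k) by rewrite expn_gt0 n0.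
rewrite -(leq_pmul2r q0) -mulnA.
apply: leq_trans (_ : net_level k u * \sum_c shatter_count (slice c) k <= _).
  by rewrite big_distrr; apply: markov => c; rewrite inE => /ltnW.
by rewrite leq_mul2l sum_shatter_count orbT.
Qed.

(** The default [set0] is reached only when [z] is not a net. *)
Definition net_exc m u (L : V -> V -> bool) (z : {ffun 'I_m -> V}) : {set V} :=
  odflt set0 [pick Exc : {set V} | (u * #|Exc| <= n) &&
    [forall x, forall x', (x \notin Exc) ==> (x' \notin Exc) ==>
       (pattern L z x == pattern L z x') ==> (u * #|diff L x x'| <= 2 * n)]].

Lemma net_excP m u (L : V -> V -> bool) (z : {ffun 'I_m -> V}) : is_net L u z ->
  u * #|net_exc u L z| <= n /\
  forall x x', x \notin net_exc u L z -> x' \notin net_exc u L z ->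
    pattern L z x = pattern L z x' -> u * #|diff L x x'| <= 2 * n.
Proof.
rewrite /net_exc => /existsP[X hX]; case: pickP => [Y /andP[Yn h]|/(_ X)]; last by rewrite hX.
split=> // x x' xY xY' exx'; move/forallP/(_ x)/forallP/(_ x'): h.
by rewrite xY xY' exx' eqxx.
Qed.

Definition net_params u :=
  [/\ 0 < u, k <= u * u & 2 * u * (8 * u * (4 * u * (u * u).+1 ^ k)) <= 2 ^ u].

Lemma poor_slice_net u c : 0 < n -> net_params u -> c \notin rich_slices u ->
  u * #|[set z : {ffun 'I_(u * u) -> V} | ~~ is_net (slice c) u z]| <= n ^ (u * u).
Proof.
by move=> n0 [u0 ku hL]; rewrite inE -leqNgt; apply: most_samples_net.
Qed.

Definition link_diff x x' : {set V * V} := [set p | e x p.1 p.2 != e x' p.1 p.2].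

Variables v u u' : nat.
Hypotheses (uE : u = v ^ 2) (uE' : u' = v ^ 5).
Hypothesis v1 : 1 < v.
Hypotheses (hu : net_params u) (hu' : net_params u').
Hypothesis n_large1 : net_level k u * k * v <= n.
Hypothesis n_large2 : 2 * (u * u) * (net_level k u' * k) <= n.
Hypothesis n0 : 0 < n.

Definition nonnet_slices (y : {ffun 'I_(u * u) -> V}) : {set V} :=
  [set c | (c \notin rich_slices u) && ~~ is_net (slice c) u y].

(** The y_i must avoid the rich slices of the finer level [u'], because [second_sample] needs nets
    for their links. For large n their bounded number is hit with probability at most 1/2, and
    Markov leaves less than 1/2 for the other event. *)
Lemma first_sample : exists y : {ffun 'I_(u * u) -> V},
  (forall i, y i \notin rich_slices u') /\ u * #|nonnet_slices y| <= 2 * n.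
Proof.
pose Y1 := \bigcup_(i : 'I_(u * u)) [set y : {ffun 'I_(u * u) -> V} | y i \in rich_slices u'].
pose Y2 := [set y | 2 * n < u * #|nonnet_slices y|].
have m0 : 0 < n ^ (u * u) by rewrite expn_gt0 n0.
have c1 : 2 * #|Y1| <= n ^ (u * u).
  rewrite -(leq_pmul2l n0) mulnCA.
  apply: leq_trans (_ : 2 * (u * u * (#|rich_slices u'| * n ^ (u * u))) <= _).
    rewrite leq_mul2l /=; apply: leq_trans (leq_mul (leqnn n) (card_bigcup_le _)) _.
    rewrite big_distrr /=; apply: leq_trans (sum_bounded (fun i => card_coord i _)) _.
    by rewrite card_ord.
  rewrite !mulnA leq_mul2r; apply/orP; right.
  apply: leq_trans n_large2.
  by rewrite -(mulnA 2 u u) leq_mul2l card_rich_slices ?orbT.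
have c2 : 2 * #|Y2| < n ^ (u * u).
  have hs : #|Y2| * (2 * n).+1 <= n * n ^ (u * u).
    apply: leq_trans (_ : \sum_y u * #|nonnet_slices y| <= _).
      by apply: markov => y; rewrite inE.
    rewrite -big_distrr /= double_count big_distrr /=; apply: sum_bounded => c.
    case cr: (c \in rich_slices u).
      by rewrite [X in _ * X]eq_card0 ?muln0 // => y; rewrite !inE.
    by apply: poor_slice_net => //; rewrite cr.
  move: hs m0; clear -n0; move: (n ^ _) (#|Y2|) => a b; nia.
have : ~~ ([set: {ffun 'I_(u * u) -> V}] \subset Y1 :|: Y2).
  apply/negP => /subset_leq_card; rewrite cardsT card_ffun card_ord leqNgt => /negP; apply.
  apply: leq_ltn_trans (leq_card_setU _ _) _; move: c1 c2 m0.
  by move: (#|Y1|) (#|Y2|) (n ^ _) => a b c; clear; lia.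
case/subsetPn => y _; rewrite in_setU negb_or => /andP[y1 y2]; exists y; split.
  by move=> i; apply: contra y1 => h; apply/bigcupP; exists i => //; rewrite in_set.
by move: y2; rewrite inE -leqNgt.
Qed.

(** Union bound: each of the u^2 slices fails with probability at most 1/u', and u^2 < u'. *)
Lemma second_sample (y : {ffun 'I_(u * u) -> V}) : (forall i, y i \notin rich_slices u') ->
  exists z : {ffun 'I_(u' * u') -> V}, forall i, is_net (slice (y i)) u' z.
Proof.
move=> hy; pose Z i := [set z : {ffun 'I_(u' * u') -> V} | ~~ is_net (slice (y i)) u' z].
have m0 : 0 < n ^ (u' * u') by rewrite expn_gt0 n0.
have hZ : u' * #|\bigcup_i Z i| <= u * u * n ^ (u' * u').
  apply: leq_trans (leq_mul (leqnn _) (card_bigcup_le _)) _; rewrite big_distrr /=.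
  apply: sum_bounded_ord => i; exact: poor_slice_net.
have uu : u * u < u' by rewrite uE uE' -expnD ltn_exp2l.
have : ~~ ([set: {ffun 'I_(u' * u') -> V}] \subset \bigcup_i Z i).
  apply/negP => /subset_leq_card; rewrite cardsT card_ffun card_ord.
  move: (#|\bigcup_i Z i|) (n ^ (u' * u')) hZ m0 => a b hZ m0 ba; nia.
case/subsetPn => z _ hz; exists z => i; apply: contraR hz => h.
by apply/bigcupP; exists i => //; rewrite in_set.
Qed.

Lemma structure_labels : exists (g : V -> {set 'I_(u * u) * 'I_(u' * u')}) (G : {set V}),
  v * #|G| <= 2 * n /\
  forall x x', x \notin G -> x' \notin G -> g x = g x' ->
    v * #|link_diff x x'| <= 9 * (n * n).
Proof.
have [y [y1 y2]] := first_sample; have [z hz] := second_sample y1.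
have v0 : 0 < v by lia.
exists (fun x => [set ij | e x (y ij.1) (z ij.2)]).
pose X i := net_exc u' (slice (y i)) z.
pose Y c := net_exc u (slice c) y.
pose gd c := (c \notin rich_slices u) && is_net (slice c) u y.
(* The exceptional set of the first net varies with [c]. Double counting shows that few [x] are
   exceptional for many [c], and these are discarded as [G2]; the choice u = v^2 pays for this. *)
pose hit x := [set c | gd c && (x \in Y c)].
pose G1 := \bigcup_i X i; pose G2 := [set x | n < v * #|hit x|].
have g1 : v * #|G1| <= n.
  have p0 : 0 < u * u by rewrite uE -expnD expn_gt0 v0.
  rewrite -(leq_pmul2l p0) mulnA (_ : u * u * v = u'); last by rewrite uE uE' -expnD -expnSr.
  apply: leq_trans (leq_mul (leqnn _) (card_bigcup_le _)) _; rewrite big_distrr /=.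
  apply: sum_bounded_ord => i.
  by have [] := net_excP (hz i).
have g2 : v * #|G2| <= n.
  have h : #|G2| * n <= \sum_x v * #|hit x| by apply: markov => x; rewrite inE => /ltnW.
  have h' : u * \sum_x #|hit x| <= n * n.
    rewrite double_count big_distrr /=; apply: sum_bounded => c.
    case gc: (gd c); last by rewrite [X in _ * X]eq_card0 ?muln0 // => x; rewrite !inE.
    have [_ nc] := andP gc; rewrite (_ : [set _ | _] = Y c); last by apply/setP => x; rewrite inE.
    by have [] := net_excP nc.
  rewrite -big_distrr /= in h; move: h h'; rewrite {1}uE -mulnn.
  move=> h h'; rewrite -(leq_pmul2r n0); apply: leq_trans h'.
  by rewrite -!mulnA leq_mul2l h orbT.
exists (G1 :|: G2); split.
  apply: leq_trans (leq_mul (leqnn v) (leq_card_setU G1 G2)) _.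
  by rewrite mulnDr mul2n -addnn leq_add.
move=> x x'; rewrite !in_setU !negb_or => /andP[x1 x2] /andP[x1' x2'] exx'.
(* By the second net, few [c] see a difference between [x] and [x'] in the slice of some [y i]. For
   every other [c] the two points have the same pattern on [y] in the slice of [c], so the first net
   applies there. The sum over the u^2 indices is paid for by u' = u^2 * v. *)
pose D := \bigcup_i diff (slice (y i)) x x'.
have cD : v * #|D| <= 2 * n.
  have p0 : 0 < u * u by rewrite uE -expnD expn_gt0 v0.
  rewrite -(leq_pmul2l p0) mulnA (_ : u * u * v = u'); last by rewrite uE uE' -expnD -expnSr.
  apply: leq_trans (leq_mul (leqnn _) (card_bigcup_le _)) _; rewrite big_distrr /=.
  apply: sum_bounded_ord => i.
  have [_] := net_excP (hz i); apply.
  - by apply: contra x1 => h; apply/bigcupP; exists i.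
  - by apply: contra x1' => h; apply/bigcupP; exists i.
  apply/setP => j; rewrite !inE /slice; have /setP/(_ (i, j)) := exx'.
  by rewrite !inE /= -e_sym23 => ->; rewrite e_sym23.
pose C := rich_slices u :|: nonnet_slices y :|: hit x :|: hit x' :|: D.
have cC : v * #|C| <= 7 * n.
  have h1 : v * #|rich_slices u| <= n.
    by apply: leq_trans n_large1; rewrite mulnC leq_mul2r card_rich_slices ?orbT.
  have h2 : v * #|nonnet_slices y| <= 2 * n.
    by apply: leq_trans y2; rewrite leq_mul2r uE -mulnn leq_pmulr ?orbT.
  have h3 : v * #|hit x| <= n by move: x2; rewrite inE -leqNgt.
  have h4 : v * #|hit x'| <= n by move: x2'; rewrite inE -leqNgt.
  have hc : #|C| <= #|rich_slices u| + #|nonnet_slices y| + #|hit x| + #|hit x'| + #|D|.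
    by do 3! [apply: leq_trans (leq_card_setU _ _) _; rewrite leq_add2r]; apply: leq_card_setU.
  apply: leq_trans (leq_mul (leqnn v) hc) _; rewrite !mulnDr.
  rewrite (_ : 7 * n = n + 2 * n + n + n + 2 * n); last by clear; lia.
  by do !apply: leq_add.
have dC c : c \notin C -> v * #|diff (slice c) x x'| <= 2 * n.
  rewrite !in_setU !negb_or => /andP[/andP[/andP[/andP[cr cn] cx] cx'] cD'].
  have nc : is_net (slice c) u y by move: cn; rewrite inE cr /= negbK.
  have gc : gd c by rewrite /gd cr nc.
  have [_ h] := net_excP nc.
  apply: leq_trans (h x x' _ _ _).
  - by rewrite leq_mul2r uE -mulnn leq_pmulr ?orbT.
  - by move: cx; rewrite inE gc.
  - by move: cx'; rewrite inE gc.
  apply/setP => i; rewrite !inE /slice; apply/eqP; apply: contraR cD' => hd.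
  by apply/bigcupP; exists i; rewrite // inE /slice e_sym23 [e x' _ _]e_sym23.
have -> : #|link_diff x x'| = \sum_c #|diff (slice c) x x'|.
  rewrite /link_diff (card_pairs (fun y0 z0 => e x y0 z0 != e x' y0 z0)) double_count.
  by apply: eq_bigr.
(* At most 7n/v slices are given up entirely; each of the others contributes at most 2n/v pairs. *)
rewrite (bigID (mem C)) /= mulnDr (_ : 9 = 7 + 2) // mulnDl; apply: leq_add.
  apply: leq_trans (_ : v * (#|C| * n) <= _).
    by rewrite leq_mul2l -sum_nat_const; apply/orP; right; apply: leq_sum => c _; apply: max_card.
  by rewrite !mulnA leq_mul2r cC orbT.
rewrite mulnCA big_distrr /= big_mkcond /=; apply: sum_bounded => c.
by case: ifP => // /dC.
Qed.

End Structure.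

(** * Choice of the parameters *)

Lemma poly_le_exp C d : exists u0, forall u, u0 <= u -> C * u ^ d <= 2 ^ u.
Proof.
exists (d.+1 * (C * d.+1 ^ d)) => u hu.
(* Split 2^u into d + 1 factors of at least 2^w: one absorbs the constants, the others absorb
   u^d. *)
pose w := u %/ d.+1.
have hw : C * d.+1 ^ d <= w by rewrite leq_divRL // mulnC.
have uw : u <= d.+1 * 2 ^ w.
  apply: leq_trans (_ : d.+1 * w.+1 <= _); last by rewrite leq_mul2l ltn_expl ?orbT.
  by apply: ltnW; rewrite mulnC ltn_ceil.
apply: leq_trans (_ : C * (d.+1 * 2 ^ w) ^ d <= _).
  by rewrite leq_mul2l; case: (d) uw => [|d'] uw; rewrite ?leqnn ?orbT // leq_exp2r // uw orbT.
rewrite expnMn mulnA; apply: leq_trans (_ : 2 ^ w * (2 ^ w) ^ d <= _).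
  by rewrite leq_mul2r (leq_trans hw) ?orbT // ltnW // ltn_expl.
by rewrite -expnM -expnD leq_exp2l // -mulnS leq_divM.
Qed.

Lemma net_params_large k : exists u0, forall u, u0 <= u -> net_params k u.
Proof.
(* Here 64 = 2 * 8 * 4 with three factors [u], and (u^2 + 1)^k <= 2^k * u^(2k). *)
have [u0 hu0] := poly_le_exp (64 * 2 ^ k) (2 * k + 3).
exists (maxn u0 k.+1) => u; rewrite geq_max => /andP[/hu0 h uk].
have u_gt0 : 0 < u := leq_ltn_trans (leq0n k) uk.
split=> //; first by apply: leq_trans (ltnW uk) _; rewrite leq_pmulr.
apply: leq_trans h.
have h1 : (u * u).+1 ^ k <= 2 ^ k * u ^ (2 * k).
  rewrite expnM -expnMn; case: (k) => // k'; rewrite leq_exp2r //.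
  have : 0 < u * u by rewrite muln_gt0 u_gt0.
  by rewrite -mulnn; lia.
rewrite expnD !expnS expn0 muln1.
have := leq_mul (leqnn (64 * (u * (u * u)))) h1.
by move: (_ ^ k) (2 ^ k) (u ^ _) => a b c; lia.
Qed.

(** * Labels for members of the property *)

Definition edge (T : finType) (E : {set {set T}}) (x y z : T) : bool := [set x; y; z] \in E.

Section Edge.
Variables (T : finType) (E : {set {set T}}).

Lemma edge_sym12 x y z : edge E x y z = edge E y x z.
Proof. by rewrite /edge [[set x; y]]setUC. Qed.

Lemma edge_sym23 x y z : edge E x y z = edge E x z y.
Proof. by rewrite /edge -!setUA [[set y] :|: _]setUC. Qed.

Lemma edge_neq x y z : is3graph E -> edge E x y z -> [/\ x != y, x != z & y != z].
Proof.
move=> E3 /E3; rewrite -setUA !cardsU1 !inE cards1.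
by case: (x == y); case: (x == z); case: (y == z).
Qed.
End Edge.

(** The three vertex classes of Trip are disjoint copies of the vertex set, so [a], [b] and [c] may
    share vertices. Shattering in a single slice, which exists as 0 < k, already forces [a] and [b]
    to be injective; for [c] this is assumed. *)
Lemma trip_kUk k (P : prop3) n (E : {set {set 'I_n}}) : 0 < k -> P n E ->
  ~ in_Trip P (kUk k) ->
  forall (a : {ffun 'I_k -> 'I_n}) (b : {ffun {set 'I_k} -> 'I_n}) (c : 'I_k -> 'I_n),
  injective c -> ~ (forall i, shatter (slice (edge E) (c i)) a b).
Proof.
move=> k0 PE nT a b c cI sh; apply: nT; exists n, E; split=> //.
have h i j S : edge E (b S) (a j) (c i) = (j \in S).
  by have /forallP/(_ j)/forallP/(_ S)/eqP := sh i.
have aI : injective a.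
  move=> j j' e; have := h (Ordinal k0) j [set j']; rewrite e h !inE eqxx.
  by move/esym/eqP.
have bI : injective b.
  by move=> S S' e; apply/setP => j; rewrite -!(h (Ordinal k0)) e.
pose f (s : kU_vert k) : 'I_(n + n + n) := match s with
  | inl (inl j) => lshift n (lshift n (a j))
  | inl (inr A) => lshift n (rshift n (b A))
  | inr i => rshift (n + n) (c i) end.
have fI : injective f.
  move=> [[j|A]|i] [[j'|A']|i'] /=; rewrite ?eq_shift //.
  - by move/lshift_inj/lshift_inj/aI->.
  - by move/lshift_inj/eqP; rewrite eq_shift.
  - by move/eqP; rewrite eq_shift.
  - by move/lshift_inj/eqP; rewrite eq_shift.
  - by move/lshift_inj/rshift_inj/bI->.
  - by move/eqP; rewrite eq_shift.
  - by move/eqP; rewrite eq_shift.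
  - by move/eqP; rewrite eq_shift.
  - by move/rshift_inj/cI->.
have fS i j A : f @: [set (inr i : kU_vert k); inl (inl j); inl (inr A)] =
    [set lshift n (lshift n (a j)); lshift n (rshift n (b A)); rshift (n + n) (c i)].
  by rewrite !imsetU !imset_set1 /= -setUA setUC.
exists f; split=> // S; rewrite !inE; apply/idP/idP.
  case/existsP => i /existsP[j /existsP[A /andP[jA /eqP->]]].
  apply/existsP; exists (a j); apply/existsP; exists (b A); apply/existsP; exists (c i).
  by rewrite fS eqxx andbT -[_ \in E]/(edge E _ _ _) edge_sym12 h.
case/existsP => v /existsP[v' /existsP[v'' /andP[vE /eqP fSE]]].
have : lshift n (lshift n v) \in f @: S by rewrite fSE !inE eqxx.
case/imsetP => -[[j|A']|i'] _ /=; last first.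
- by move/eqP; rewrite eq_shift.
- by move/lshift_inj/eqP; rewrite eq_shift.
move/lshift_inj/lshift_inj => ev.
have : lshift n (rshift n v') \in f @: S by rewrite fSE !inE eqxx orbT.
case/imsetP => -[[j'|A]|i'] _ /=; last first.
- by move/eqP; rewrite eq_shift.
- move/lshift_inj/rshift_inj => ev'.
  have : rshift (n + n) v'' \in f @: S by rewrite fSE !inE eqxx !orbT.
  case/imsetP => -[[j'|A']|i] _ /=; last first.
  + move/rshift_inj => ev''.
    move: vE fSE; rewrite ev ev' ev'' -fS -/(edge E (a j) (b A) (c i)) edge_sym12 h => jA fSE.
    apply/existsP; exists i; apply/existsP; exists j; apply/existsP; exists A.
    by rewrite jA; apply/eqP/(imset_inj fI).
  + by move/eqP; rewrite eq_shift.
  + by move/eqP; rewrite eq_shift.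
- by move/lshift_inj/eqP; rewrite eq_shift.
Qed.

Definition label_type v : finType := {set 'I_(v ^ 2 * v ^ 2) * 'I_(v ^ 5 * v ^ 5)}.

Lemma card_label_type v : #|label_type v| = 2 ^ (v ^ 14).
Proof. by rewrite card_set_type card_prod !card_ord -!expnD. Qed.

(** The threshold [N] makes the boundedly many rich slices negligible; it depends on [k] and [v] but
    not on the property. *)
Lemma close_links k : 0 < k -> exists v0, forall v, v0 <= v -> exists N,
  forall (P : prop3) n (E : {set {set 'I_n}}), ~ in_Trip P (kUk k) -> P n E -> N <= n ->
  exists (g : 'I_n -> label_type v) (G : {set 'I_n}), v * #|G| <= 2 * n /\
    forall x x', x \notin G -> x' \notin G -> g x = g x' ->
      v * #|link_diff (edge E) x x'| <= 9 * (n * n).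
Proof.
move=> k0; have [u0 hu0] := net_params_large k.
exists (maxn 2 u0) => v; rewrite geq_max => /andP[v1 vu].
exists (maxn 1 (maxn (net_level k (v ^ 2) * k * v)
  (2 * (v ^ 2 * v ^ 2) * (net_level k (v ^ 5) * k)))) => P n E nT PE.
rewrite !geq_max => /and3P[n0 n1 n2].
have vp d : 0 < d -> v <= v ^ d.
  by case: d => // d _; rewrite expnS leq_pmulr // expn_gt0 (ltnW v1).
have p2 : net_params k (v ^ 2) by apply/hu0/(leq_trans vu)/vp.
have p5 : net_params k (v ^ 5) by apply/hu0/(leq_trans vu)/vp.
have := @structure_labels _ (edge E) k (@edge_sym23 _ E) (trip_kUk k0 PE nT) v _ _ erefl erefl v1 p2 p5.
by rewrite !card_ord; apply.
Qed.

(** * Homogeneous partitions *)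

Lemma sum_mull (T : finType) (A : {set T}) (F : T -> nat) m :
  (\sum_(x in A) F x) * m = \sum_(x in A) F x * m.
Proof. exact: big_distrl. Qed.

Lemma sum_mulr (T : finType) (A : {set T}) (F : T -> nat) m :
  m * (\sum_(x in A) F x) = \sum_(x in A) m * F x.
Proof. exact: big_distrr. Qed.

Section Homogeneous.
Variables (V Lab : finType) (e : V -> V -> V -> bool) (lab : V -> Lab).
Local Notation n := #|V|.
Hypothesis e_sym12 : forall x y z, e x y z = e y x z.
Hypothesis e_sym23 : forall x y z, e x y z = e x z y.

Definition block l : {set V} := [set x | lab x == l].

Lemma sum_block (f : V -> nat) : \sum_x f x = \sum_l \sum_(x in block l) f x.
Proof.
rewrite (partition_big lab xpredT) //=; apply: eq_bigr => l _.
by apply: eq_bigl => x; rewrite inE.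
Qed.

Lemma sum_block_const (f : Lab -> nat) : \sum_x f (lab x) = \sum_l #|block l| * f l.
Proof.
rewrite sum_block; apply: eq_bigr => l _; rewrite -sum_nat_const.
by apply: eq_bigr => x; rewrite inE => /eqP->.
Qed.

Definition disagreements (A B C : {set V}) :=
  \sum_(a in A) \sum_(a' in A) \sum_(b in B) \sum_(c in C) (e a b c != e a' b c : nat).

Definition edges_in (A B C : {set V}) :=
  \sum_(a in A) \sum_(b in B) \sum_(c in C) (e a b c : nat).
Definition nonedges_in (A B C : {set V}) :=
  \sum_(a in A) \sum_(b in B) \sum_(c in C) (~~ e a b c : nat).

Lemma edges_nonedges A B C : edges_in A B C + nonedges_in A B C = #|A| * (#|B| * #|C|).
Proof.
rewrite -big_split -sum_nat_const; apply: eq_bigr => a _.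
rewrite -big_split -sum_nat_const; apply: eq_bigr => b _.
rewrite -big_split -[RHS]muln1 -sum_nat_const; apply: eq_bigr => c _.
by case: (e a b c).
Qed.

(* Change the three coordinates one at a time along a path of triples. *)
Lemma edges_nonedges_disagreements A B C :
  edges_in A B C * nonedges_in A B C <=
    disagreements A B C * (#|B| * #|C|) + disagreements B A C * (#|A| * #|C|) +
    disagreements C A B * (#|A| * #|B|).
Proof.
(* All three take the six variables of a pair of triples, so that they are summed over the same
   paths; the two variables that do not occur in a step later become the cardinality factors. *)
pose d1 a a' b (b' : V) c (c' : V) := (e a b c != e a' b c : nat).
pose d2 (a : V) a' b b' c (c' : V) := (e a' b c != e a' b' c : nat).
pose d3 (a : V) a' (b : V) b' c c' := (e a' b' c != e a' b' c' : nat).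
pose S (d : V -> V -> V -> V -> V -> V -> nat) := \sum_(a in A) \sum_(a' in A)
  \sum_(b in B) \sum_(b' in B) \sum_(c in C) \sum_(c' in C) d a a' b b' c c'.
apply: leq_trans (_ : S d1 + S d2 + S d3 <= _).
  rewrite big_distrlr -!big_split; apply: leq_sum => a _ /=; rewrite -!big_split.
  apply: leq_sum => a' _ /=; rewrite big_distrlr -!big_split; apply: leq_sum => b _ /=.
  rewrite -!big_split; apply: leq_sum => b' _ /=; rewrite big_distrlr -!big_split.
  apply: leq_sum => c _ /=; rewrite -!big_split; apply: leq_sum => c' _ /=.
  by rewrite /d1 /d2 /d3; case: (e a b c); case: (e a' b c); case: (e a' b' c); case: (e a' b' c').
apply: leq_add; first apply: leq_add; apply: eq_leq.
- rewrite sum_mull; apply: eq_bigr => a _; rewrite sum_mull; apply: eq_bigr => a' _.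
  rewrite sum_mull; apply: eq_bigr => b _.
  rewrite mulnCA -sum_nat_const; apply: eq_bigr => b' _.
  rewrite sum_mull; apply: eq_bigr => c _.
  by rewrite mulnC -sum_nat_const.
- rewrite mulnC -mulnA -sum_nat_const; apply: eq_bigr => a _ /=.
  rewrite sum_mulr exchange_big /=; apply: eq_bigr => b _.
  rewrite sum_mulr exchange_big /=; apply: eq_bigr => b' _.
  rewrite sum_mulr /=; apply: eq_bigr => a' _; rewrite sum_mulr /=; apply: eq_bigr => c _.
  rewrite -sum_nat_const; apply: eq_bigr => c' _.
  by rewrite /d2 e_sym12 [e a' b' c]e_sym12.
- rewrite mulnC -mulnA -sum_nat_const; apply: eq_bigr => a _ /=.
  transitivity (\sum_(a' in A) #|B| * \sum_(b' in B) \sum_(c in C) \sum_(c' in C)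
     (e c a' b' != e c' a' b' : nat)).
    apply: eq_bigr => a' _; rewrite -sum_nat_const; apply: eq_bigr => b _.
    apply: eq_bigr => b' _; apply: eq_bigr => c _; apply: eq_bigr => c' _.
    by rewrite /d3 e_sym23 e_sym12 [e a' b' c']e_sym23 [e a' c' b']e_sym12.
  rewrite -sum_mulr /=; congr (_ * _); rewrite /disagreements.
  under eq_bigr do rewrite exchange_big; rewrite exchange_big /=; apply: eq_bigr => c _.
  under eq_bigr do rewrite exchange_big; rewrite exchange_big /=; apply: eq_bigr => c' _.
  by [].
Qed.

Variable (w : nat).

Definition heterogeneous (A B C : {set V}) :=
  (#|A| * (#|B| * #|C|) <= w * edges_in A B C) &&
  (#|A| * (#|B| * #|C|) <= w * nonedges_in A B C).

Definition unstable (A B C : {set V}) :=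
  #|A| * #|A| * (#|B| * #|C|) <= 3 * (w * w) * disagreements A B C.

(** Edge and nonedge densities of at least 1/w have product at least 1/w^2. The normalised
    disagreements in the three directions add up to at least this, so one of them is at least
    1/(3w^2). *)
Lemma heterogeneous_unstable (A B C : {set V}) : 0 < #|A| -> 0 < #|B| -> 0 < #|C| ->
  heterogeneous A B C -> [|| unstable A B C, unstable B A C | unstable C A B].
Proof.
move=> A0 B0 C0 /andP[h1 h2]; apply: contraT.
rewrite /unstable !negb_or -!ltnNge => /and3P[u1 u2 u3].
have := leq_mul h1 h2; rewrite leqNgt => /negP; case.
have h := edges_nonedges_disagreements A B C.
rewrite mulnACA; apply: leq_ltn_trans (leq_mul (leqnn (w * w)) h) _.
move: u1 u2 u3 A0 B0 C0; move: (disagreements A B C) (disagreements B A C) (disagreements C A B).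
move: (#|A|) (#|B|) (#|C|) (w * w) => a b c ww d1 d2 d3 u1 u2 u3 a0 b0 c0; clear -u1 u2 u3 a0 b0 c0.
have bc0 : 0 < b * c by rewrite muln_gt0 b0.
have ac0 : 0 < a * c by rewrite muln_gt0 a0.
have ab0 : 0 < a * b by rewrite muln_gt0 a0.
move: u1 u2 u3; rewrite -(ltn_pmul2r bc0) => u1; rewrite -(ltn_pmul2r ac0) => u2.
rewrite -(ltn_pmul2r ab0) => u3; lia.
Qed.

Variables (v : nat) (good : pred Lab).
Hypothesis block_close : forall x x', good (lab x) -> lab x = lab x' ->
  v * #|link_diff e x x'| <= 9 * (n * n).

(** Summed over all pairs of blocks, the disagreements of the block [A] of [x] are exactly the link
    differences within [A], at most 9 n^2/v for each pair of its vertices. Markov's inequality gives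
    27 = 3 * 9. *)
Lemma unstable_count x : good (lab x) ->
  v * #|[set p : V * V | unstable (block (lab x)) (block (lab p.1)) (block (lab p.2))]|
    <= 27 * (w * w) * (n * n).
Proof.
move=> xG; set A := block (lab x).
have A0 : 0 < #|A| * #|A| by rewrite muln_gt0 andbb; apply/card_gt0P; exists x; rewrite inE.
rewrite -(leq_pmul2l A0).
rewrite (card_pairs (fun y z => unstable A (block (lab y)) (block (lab z)))).
under eq_bigr do rewrite card_sum_bool.
have dA : \sum_l \sum_l' disagreements A (block l) (block l') =
    \sum_(a in A) \sum_(a' in A) #|link_diff e a a'|.
  rewrite /disagreements; under eq_bigr do rewrite exchange_big /=.
  rewrite exchange_big; apply: eq_bigr => a _.
  under eq_bigr do rewrite exchange_big /=; rewrite exchange_big; apply: eq_bigr => a' _ /=.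
  rewrite (card_pairs (fun y z => e a y z != e a' y z)) sum_block; apply: eq_bigr => l _.
  rewrite exchange_big; apply: eq_bigr => b _; rewrite card_sum_bool sum_block.
  by apply: eq_bigr.
apply: leq_trans (_ : v * (3 * (w * w) * \sum_l \sum_l' disagreements A (block l) (block l')) <= _).
  rewrite mulnCA leq_mul2l; apply/orP; right.
  rewrite (sum_block_const (fun l => \sum_z (unstable A (block l) (block (lab z)) : nat))).
  rewrite !big_distrr; apply: leq_sum => l _ /=.
  rewrite (sum_block_const (fun l' => (unstable A (block l) (block l') : nat))).
  rewrite !big_distrr /=; apply: leq_sum => l' _.
  case hb: (unstable _ _ _); last by rewrite !muln0.
  by rewrite muln1; apply: leq_trans hb; rewrite mulnA.
rewrite dA mulnCA (_ : _ * (27 * _ * _) = 3 * (w * w) * (#|A| * #|A| * (9 * (n * n)))); last by lia.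
rewrite leq_mul2l; apply/orP; right.
rewrite -mulnA -sum_nat_const big_distrr /=; apply: leq_sum => a aA.
rewrite -sum_nat_const big_distrr /=; apply: leq_sum => a' a'A.
move: aA a'A; rewrite !inE => /eqP aA /eqP a'A.
by apply: block_close; rewrite ?aA ?a'A.
Qed.

End Homogeneous.

Section TripleCount.
Variable V : finType.
Implicit Type Q : V -> V -> V -> bool.

Definition triple_count Q := \sum_x \sum_y \sum_z (Q x y z : nat).

Lemma card_triple_set Q : #|[set t : V * V * V | Q t.1.1 t.1.2 t.2]| = triple_count Q.
Proof.
rewrite (card_pairs (fun p z => Q p.1 p.2 z)) /triple_count pair_bigA /=.
by apply: eq_bigr => p _; rewrite card_sum_bool.
Qed.

Lemma triple_count_swap12 Q : triple_count (fun x y z => Q y x z) = triple_count Q.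
Proof. exact: exchange_big. Qed.

Lemma triple_count_swap23 Q : triple_count (fun x y z => Q x z y) = triple_count Q.
Proof. by apply: eq_bigr => x _; apply: exchange_big. Qed.

Lemma triple_count_rot Q : triple_count (fun x y z => Q z x y) = triple_count Q.
Proof.
by rewrite (triple_count_swap23 (fun x z y => Q z x y)) triple_count_swap12.
Qed.

Lemma triple_count_fst (A : {set V}) :
  triple_count (fun x _ _ => x \in A) = #|A| * (#|V| * #|V|).
Proof.
rewrite -sum_nat_const [RHS]big_mkcond; apply: eq_bigr => x _.
rewrite sum_nat_const sum_nat_const; case: (x \in A); first by rewrite muln1.
by rewrite !muln0.
Qed.

End TripleCount.

Section HeterogeneousCount.
Variables (V Lab : finType) (e : V -> V -> V -> bool) (lab : V -> Lab).
Local Notation n := #|V|.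
Hypothesis e_sym12 : forall x y z, e x y z = e y x z.
Hypothesis e_sym23 : forall x y z, e x y z = e x z y.
Variables (v w : nat) (good : pred Lab).
Hypothesis block_close : forall x x', good (lab x) -> lab x = lab x' ->
  v * #|link_diff e x x'| <= 9 * (n * n).
Hypothesis few_bad : v * #|[set x | ~~ good (lab x)]| <= 2 * n.
Hypotheses (w0 : 0 < w) (vw : 87 * w ^ 3 <= v).

Let blk x := block lab (lab x).

(** A heterogeneous triple is unstable in one of three directions, at a good vertex, or contains a
    bad vertex: 87 = 3 * 27 + 3 * 2. In w^3, two factors come from [unstable_count] and one is the
    precision 1/w to be reached. *)
Lemma heterogeneous_count :
  w * triple_count (fun x y z => heterogeneous e w (blk x) (blk y) (blk z)) <= n ^ 3.
Proof.
pose G := [set x | ~~ good (lab x)].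
pose Q x y z := good (lab x) && unstable e w (blk x) (blk y) (blk z).
have hQ : v * triple_count Q <= 27 * (w * w) * n ^ 3.
  rewrite (_ : _ * n ^ 3 = n * (27 * (w * w) * (n * n))); last by rewrite !expnS expn0; clear; lia.
  rewrite /triple_count big_distrr; apply: sum_bounded => x /=.
  case gx: (good (lab x)); last first.
    by rewrite big1 ?muln0 // => y _; rewrite big1 // => z _; rewrite /Q gx.
  apply: leq_trans (unstable_count w block_close gx).
  rewrite (card_pairs (fun y z => unstable e w (blk x) (blk y) (blk z))).
  rewrite leq_mul2l; apply/orP; right; apply: leq_sum => y _; rewrite card_sum_bool.
  by apply: leq_sum => z _; rewrite /Q gx.
have hG : v * triple_count (fun x _ _ => x \in G) <= 2 * n ^ 3.
  rewrite triple_count_fst mulnA (_ : 2 * n ^ 3 = 2 * n * (n * n)).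
    by rewrite leq_mul2r few_bad orbT.
  by rewrite !expnS expn0; clear; lia.
set het := fun x y z => heterogeneous _ _ _ _ _.
have : triple_count het <= 3 * triple_count Q + 3 * triple_count (fun x _ _ => x \in G).
  have -> : 3 * triple_count Q = triple_count Q + triple_count (fun x y z => Q y x z) +
      triple_count (fun x y z => Q z x y).
    by rewrite (triple_count_swap12 Q) (triple_count_rot Q) !mulSn addn0 addnA.
  have -> : 3 * triple_count (fun x _ _ => x \in G) = triple_count (fun x _ _ => x \in G) +
      triple_count (fun _ x _ => x \in G) + triple_count (fun _ _ x => x \in G).
    rewrite (triple_count_swap12 (fun x _ _ => x \in G)).
    by rewrite (triple_count_rot (fun x _ _ => x \in G)) !mulSn addn0 addnA.
  rewrite /triple_count -!big_split; apply: leq_sum => x _ /=.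
  rewrite -!big_split; apply: leq_sum => y _ /=; rewrite -!big_split; apply: leq_sum => z _ /=.
  case hh: (het x y z) => //.
  have b0 t : 0 < #|blk t| by apply/card_gt0P; exists t; rewrite inE.
  have /or3P := heterogeneous_unstable e_sym12 e_sym23 (b0 x) (b0 y) (b0 z) hh.
  rewrite /Q !inE => -[] ->; case: (good (lab x)); case: (good (lab y)); case: (good (lab z));
    by rewrite //= ?addnS.
move=> h; have w2 : 0 < 87 * (w * w) by rewrite !muln_gt0 w0.
rewrite -(leq_pmul2l w2) mulnA.
apply: leq_trans (_ : v * triple_count het <= _).
  by rewrite leq_mul2r (_ : _ * w = 87 * w ^ 3) ?vw ?orbT // !expnS expn0; clear; lia.
apply: leq_trans (leq_mul (leqnn v) h) _; rewrite mulnDr mulnCA [v * (3 * _)]mulnCA.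
have := leq_add (leq_mul (leqnn 3) hQ) (leq_mul (leqnn 3) hG); move/leq_trans; apply.
have := leq_mul w0 w0; move: (w * w) (n ^ 3) => a b; clear; nia.
Qed.
End HeterogeneousCount.

(** * From counts to real densities *)

Section INR.
Open Scope R_scope.
Lemma INR_add a b : INR (a + b)%N = INR a + INR b. Proof. exact: plus_INR. Qed.
Lemma INR_mul a b : INR (a * b)%N = INR a * INR b. Proof. exact: mult_INR. Qed.
Lemma INR_leq a b : (a <= b)%N -> INR a <= INR b. Proof. by move/leP; apply: le_INR. Qed.
Lemma INR_ltn a b : (a < b)%N -> INR a < INR b. Proof. by move/ltP; apply: lt_INR. Qed.
Lemma le_INR_nat a b : INR a <= INR b -> (a <= b)%N. Proof. by move/INR_le/leP. Qed.
Lemma INR_exp a b : INR (a ^ b)%N = INR a ^ b.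
Proof. by elim: b => [|b IH]; rewrite ?expn0 // expnS INR_mul IH. Qed.
End INR.

Section HomPartition.
Open Scope R_scope.
Variables (T : finType) (E : {set {set T}}).

Lemma card_triples (X Y Z : {set T}) : #|triples E X Y Z| = edges_in (edge E) X Y Z.
Proof.
rewrite /triples (card_triple_set (fun x y z => [&& x \in X, y \in Y, z \in Z & edge E x y z])).
rewrite /edges_in [RHS]big_mkcond; apply: eq_bigr => x _; case: (x \in X); last first.
  by rewrite big1 // => y _; rewrite big1.
rewrite [RHS]big_mkcond; apply: eq_bigr => y _; case: (y \in Y); last by rewrite big1.
by rewrite [RHS]big_mkcond; apply: eq_bigr => z _; case: (z \in Z).
Qed.

Lemma not_heterogeneous_hom (w : nat) delta (X Y Z : {set T}) :
  (0 < #|X|)%N -> (0 < #|Y|)%N -> (0 < #|Z|)%N -> 1 <= INR w * delta ->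
  ~~ heterogeneous (edge E) w X Y Z -> hom_triple E delta X Y Z.
Proof.
move=> X0 Y0 Z0 wd; rewrite /hom_triple /density card_triples -mulnA.
have := edges_nonedges (edge E) X Y Z; rewrite /heterogeneous.
have: (0 < #|X| * (#|Y| * #|Z|))%N by rewrite !muln_gt0 X0 Y0.
move: (edges_in _ _ _ _) (nonedges_in _ _ _ _) (#|X| * _)%N => a b N.
move=> N0 abN; rewrite negb_and -!ltnNge.
have {}N0 : 0 < INR N by apply: (lt_INR 0); apply/ltP.
have eN : INR N = INR a + INR b by rewrite -INR_add abN.
have a0 := pos_INR a; have b0 := pos_INR b; have w0 := pos_INR w.
have key x : INR w * x < INR N -> x < delta * INR N.
  move=> h; have [//|h'] := Rlt_le_dec x (delta * INR N).
  have := Rmult_le_compat_l _ _ _ w0 h'; nra.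
have lt1 x y : x < y * INR N -> x / INR N < y.
  by move=> h; apply: (Rmult_lt_reg_r (INR N)) => //; rewrite /Rdiv Rmult_assoc Rinv_l; lra.
have gt1 x y : y * INR N < x -> y < x / INR N.
  by move=> h; apply: (Rmult_lt_reg_r (INR N)) => //; rewrite /Rdiv Rmult_assoc Rinv_l; lra.
case/orP => /INR_ltn; rewrite INR_mul => /key h; [left|right]; split.
- by apply: Rmult_le_pos => //; apply/Rlt_le/Rinv_0_lt_compat.
- exact: lt1.
- by apply: gt1; lra.
- by apply: (Rmult_le_reg_r (INR N)) => //; rewrite /Rdiv Rmult_assoc Rinv_l; lra.
Qed.

Variables (Lab : finType) (lab : T -> Lab).

(** Indexed by vertices and not by labels, so that no part is empty. *)
Definition block_partition : {set {set T}} := [set block lab (lab x) | x in T].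

Lemma block_partitionP : partition block_partition [set: T].
Proof.
apply/and3P; split.
- apply/eqP/setP => x; rewrite inE; apply/bigcupP; exists (block lab (lab x)).
    by apply/imsetP; exists x.
  by rewrite inE.
- apply/trivIsetP => _ _ /imsetP[x _ ->] /imsetP[y _ ->]; apply: contraR.
  case/pred0Pn => z /=; rewrite !inE => /andP[/eqP zx /eqP zy].
  by rewrite -zx -zy.
apply/negP => /imsetP[x _ /setP/(_ x)]; by rewrite !inE eqxx.
Qed.

Lemma card_block_partition : (#|block_partition| <= #|Lab|)%N.
Proof.
apply: leq_trans (_ : #|[set block lab l | l in Lab]| <= _)%N.
  by apply: subset_leq_card; apply/subsetP => _ /imsetP[x _ ->]; apply: imset_f.
exact: leq_trans (leq_imset_card _ _) (max_card _).
Qed.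

Lemma hom_partition_blocks (v w : nat) delta (good : pred Lab) :
  (forall x x', good (lab x) -> lab x = lab x' ->
    v * #|link_diff (edge E) x x'| <= 9 * (#|T| * #|T|))%N ->
  (v * #|[set x | ~~ good (lab x)]| <= 2 * #|T|)%N ->
  (0 < w)%N -> (87 * w ^ 3 <= v)%N -> 1 <= INR w * delta ->
  hom_partition E delta block_partition.
Proof.
move=> close fb w0 vw wd; split; first exact: block_partitionP.
pose blk x := block lab (lab x).
pose het x y z := heterogeneous (edge E) w (blk x) (blk y) (blk z).
have h : (w * #|[set t : T * T * T | het t.1.1 t.1.2 t.2]| <= #|T| ^ 3)%N.
  rewrite card_triple_set; apply: (heterogeneous_count _ _ close fb) => //.
    exact: edge_sym12.
  exact: edge_sym23.
exists (~: [set t : T * T * T | het t.1.1 t.1.2 t.2]); split.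
  have := cardsC [set t : T * T * T | het t.1.1 t.1.2 t.2].
  rewrite !card_prod (_ : (#|T| * #|T| * #|T|)%N = (#|T| ^ 3)%N); last first.
    by rewrite !expnS expn0 muln1 mulnA.
  move: h; move: (#|[set _ | _]|) (#|~: _|) (#|T| ^ 3)%N => a b N /INR_leq.
  rewrite INR_mul => h abN.
  have a0 := pos_INR a; have w1 : 0 < INR w by apply: (lt_INR 0); apply/ltP.
  have d0 : 0 < delta by nra.
  have := Rmult_le_compat_l _ _ _ (Rlt_le _ _ d0) h.
  have := Rmult_le_compat_r _ _ _ a0 wd.
  by move: (INR_add a b); rewrite abN; nra.
move=> t; rewrite !inE => ht; exists (blk t.1.1), (blk t.1.2), (blk t.2).
split; first by split; apply: imset_f.
split; first by split; rewrite inE.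
by apply: (not_heterogeneous_hom (w := w)) => //; apply/card_gt0P; eexists; rewrite inE.
Qed.

End HomPartition.

(** All exceptional vertices share the label [None]; this one additional block is the successor in
    the bound. *)
Lemma hom_bound k : 0 < k -> exists v0, forall (P : prop3) w delta,
  ~ in_Trip P (kUk k) -> 0 < w -> Rle 1 (INR w * delta) ->
  M_hom_ok P delta (2 ^ ((v0 + 87 * w ^ 3) ^ 14)).+1.
Proof.
move=> k0; have [v0 hv0] := close_links k0; exists v0 => P w delta nT w0 wd.
set v := v0 + _; have [N hN] := hv0 v (leq_addr _ _); exists N => n E PE Nn.
have [g [G [hG hg]]] := hN P n E nT PE Nn.
pose lab x := if x \in G then None else Some (g x).
exists (block_partition lab); split.
  apply: leq_trans (card_block_partition _) _; by rewrite card_option card_label_type.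
have labG x : isSome (lab x) = (x \notin G) by rewrite /lab; case: (x \in G).
apply: (@hom_partition_blocks _ E _ lab v w delta isSome) => //.
- move=> x x' gx exx'; have gx' : isSome (lab x') by rewrite -exx'.
  move: gx gx'; rewrite !labG card_ord => gx gx'; apply: hg => //.
  by move: exx'; rewrite /lab (negbTE gx) (negbTE gx') => -[].
- rewrite card_ord (_ : [set x | _] = G) //; apply/setP => x.
  by rewrite inE labG negbK.
exact: leq_addl.
Qed.

(** * Homogeneous partitions are regular *)

Lemma sum_subset (T : finType) (A B : {set T}) (f g : T -> nat) :
  A \subset B -> (forall x, f x <= g x) -> \sum_(x in A) f x <= \sum_(x in B) g x.
Proof.
move=> /subsetP AB fg; rewrite big_mkcond [X in _ <= X]big_mkcond; apply: leq_sum => x _.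
by case: ifP => [/AB->|] //.
Qed.

Section HomReg.
Open Scope R_scope.
Variables (T : finType) (E : {set {set T}}).

Lemma density_range (X Y Z : {set T}) : (0 < #|X|)%N -> (0 < #|Y|)%N -> (0 < #|Z|)%N ->
  INR (edges_in (edge E) X Y Z) = density E X Y Z * INR (#|X| * (#|Y| * #|Z|))%N /\
  INR (nonedges_in (edge E) X Y Z) = (1 - density E X Y Z) * INR (#|X| * (#|Y| * #|Z|))%N.
Proof.
move=> X0 Y0 Z0; rewrite /density card_triples -mulnA.
have := edges_nonedges (edge E) X Y Z.
have: (0 < #|X| * (#|Y| * #|Z|))%N by rewrite !muln_gt0 X0 Y0.
move: (edges_in _ _ _ _) (nonedges_in _ _ _ _) (#|X| * _)%N => a b N N0 abN.
have {}N0 : 0 < INR N by apply: (lt_INR 0); apply/ltP.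
have eN : INR N = INR a + INR b by rewrite -INR_add abN.
by split; [field; lra | rewrite Rmult_minus_distr_r; field_simplify; lra].
Qed.

(** Subsets of relative size eps keep a fraction eps^3 of the triples, so a density below eps^4/2
    stays below eps on them. The dense case is the same for nonedges. *)
Lemma hom_reg eps (X Y Z : {set T}) : (0 < #|X|)%N -> (0 < #|Y|)%N -> (0 < #|Z|)%N ->
  0 < eps <= 1 -> hom_triple E (eps ^ 4 / 2) X Y Z -> reg_triple E eps X Y Z.
Proof.
move=> X0 Y0 Z0 [e0 e1] hom X' Y' Z' sX sY sZ hX hY hZ.
have pos (A : {set T}) : (0 < #|A|)%N -> 0 < INR #|A| by move=> h; apply: (lt_INR 0); apply/ltP.
have pos' (A A' : {set T}) : (0 < #|A|)%N -> eps * INR #|A| <= INR #|A'| -> (0 < #|A'|)%N.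
  move=> /pos h h'; rewrite lt0n; apply/eqP => A'0; move: h'; rewrite A'0 /=; nra.
have X'0 := pos' _ _ X0 hX; have Y'0 := pos' _ _ Y0 hY; have Z'0 := pos' _ _ Z0 hZ.
have [d1 d2] := density_range X0 Y0 Z0; have [d1' d2'] := density_range X'0 Y'0 Z'0.
have le1 : INR (edges_in (edge E) X' Y' Z') <= INR (edges_in (edge E) X Y Z).
  apply/INR_leq/sum_subset => // x; apply: sum_subset => // y; exact: sum_subset.
have le2 : INR (nonedges_in (edge E) X' Y' Z') <= INR (nonedges_in (edge E) X Y Z).
  apply/INR_leq/sum_subset => // x; apply: sum_subset => // y; exact: sum_subset.
have ge1 : 0 <= INR (edges_in (edge E) X' Y' Z') by apply: pos_INR.
have ge2 : 0 <= INR (nonedges_in (edge E) X' Y' Z') by apply: pos_INR.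
have ge3 : 0 <= INR (edges_in (edge E) X Y Z) by apply: pos_INR.
have ge4 : 0 <= INR (nonedges_in (edge E) X Y Z) by apply: pos_INR.
move: d1 d2 d1' d2' le1 le2 ge1 ge2 ge3 ge4 hom; rewrite /hom_triple.
move: (INR (edges_in _ _ _ _)) (INR (nonedges_in _ _ _ _)) => a b.
move: (INR (edges_in _ _ _ _)) (INR (nonedges_in _ _ _ _)) => a' b'.
move: (density E X Y Z) (density E X' Y' Z') => d d'; rewrite !INR_mul.
have hN : eps ^ 3 * (INR #|X| * (INR #|Y| * INR #|Z|)) <=
    INR #|X'| * (INR #|Y'| * INR #|Z'|).
  have -> : eps ^ 3 * (INR #|X| * (INR #|Y| * INR #|Z|)) =
    eps * INR #|X| * (eps * INR #|Y| * (eps * INR #|Z|)) by ring.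
  have ? := pos _ X0; have ? := pos _ Y0; have ? := pos _ Z0.
  apply: Rmult_le_compat => //; try nra; last apply: Rmult_le_compat => //; try nra.
  by apply: Rmult_le_pos; nra.
have N0 : 0 < INR #|X| * (INR #|Y| * INR #|Z|).
  by do 2! [apply: Rmult_lt_0_compat; first exact: pos]; apply: pos.
have N'0 : 0 < INR #|X'| * (INR #|Y'| * INR #|Z'|).
  by do 2! [apply: Rmult_lt_0_compat; first exact: pos]; apply: pos.
move: hN N0 N'0; move: (INR #|X| * _) (INR #|X'| * _) => N N' hN N0 N'0.
have key x x' : 0 <= x * N -> 0 <= x' * N' -> x' * N' <= x * N -> x < eps ^ 4 / 2 ->
    0 <= x < eps /\ 0 <= x' < eps.
  move=> x0 x0' le lt.
  have x0n : 0 <= x by nra.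
  have x0n' : 0 <= x' by nra.
  have e3 : 0 < eps ^ 3 by apply: pow_lt.
  have e3' : eps ^ 3 <= 1 by have := pow_incr eps 1 3 (conj (Rlt_le _ _ e0) e1); rewrite pow1.
  have e4 : eps ^ 4 = eps * eps ^ 3 by [].
  rewrite e4 in lt; split; split=> //; first by nra.
  have h1 : x' * (eps ^ 3 * N) <= x * N.
    by apply: Rle_trans le; apply: Rmult_le_compat_l.
  have h2 : (x' * eps ^ 3) * N <= x * N by lra.
  have h3 := Rmult_le_reg_r _ _ _ N0 h2.
  have h4 : x' * eps ^ 3 < eps * eps ^ 3 by nra.
  exact: (Rmult_lt_reg_r _ _ _ e3 h4).
move=> da db da' db' le1 le2 ge1 ge2 ge3 ge4 [[_ hd]|[hd _]].
  have [||||[? ?] [? ?]] := key d d'; try lra.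
  by apply: Rabs_le; lra.
have [||||[? ?] [? ?]] := key (1 - d) (1 - d'); try lra.
by apply: Rabs_le; lra.
Qed.

Lemma hom_reg_partition eps Pt : 0 < eps <= 1 ->
  hom_partition E (eps ^ 4 / 2) Pt -> reg_partition E eps Pt.
Proof.
move=> [e0 e1] [part [S [hS h]]]; split=> //; exists S; split.
  apply: Rle_trans hS; apply: Rmult_le_compat_r; first exact: pos_INR.
  have h3 : eps ^ 3 <= 1 by have := pow_incr eps 1 3 (conj (Rlt_le _ _ e0) e1); rewrite pow1.
  have -> : eps ^ 4 = eps * eps ^ 3 by [].
  by nra.
have ne X : X \in Pt -> (0 < #|X|)%N.
  by case/and3P: part => _ _ n0 XP; rewrite card_gt0; apply: contraNneq n0 => <-.
move=> t /h[X [Y [Z [[XP YP ZP] [tXYZ hom]]]]]; exists X, Y, Z; split=> //; split=> //.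
by apply: hom_reg => //; apply: ne.
Qed.

End HomReg.

Lemma M_hom_reg P eps M : Rlt 0 eps /\ Rle eps 1 ->
  M_hom_ok P (Rdiv (pow eps 4) 2) M -> M_reg_ok P eps M.
Proof.
move=> he [N hN]; exists N => n E' PE Nn; have [Pt [c hP]] := hN n E' PE Nn.
by exists Pt; split=> //; apply: hom_reg_partition.
Qed.

(** * Boxes in dense sets of tuples *)

Section Update.
Variables (I V : finType).
Implicit Type r : {ffun I -> V}.

Definition upd r i x : {ffun I -> V} := [ffun j => if j == i then x else r j].

Lemma updE r i x : upd r i x i = x. Proof. by rewrite ffunE eqxx. Qed.
Lemma upd_neq r i x j : j != i -> upd r i x j = r j.
Proof. by rewrite ffunE => /negbTE->. Qed.
Lemma upd_upd r i x y : upd (upd r i x) i y = upd r i y.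
Proof. by apply/ffunP => j; rewrite !ffunE; case: eqP. Qed.
Lemma upd_id r i : upd r i (r i) = r.
Proof. by apply/ffunP => j; rewrite !ffunE; case: eqP => // ->. Qed.

(* Exchanging x with r (lab x) is an involution on the pairs (r, x). *)
Lemma sum_swap (lab : V -> I) (P : pred {ffun I -> V}) (Q : pred V)
    (F : {ffun I -> V} -> V -> nat) :
  (forall r x, P r -> Q x -> [/\ P (upd r (lab x) x), Q (r (lab x)) & lab (r (lab x)) = lab x]) ->
  \sum_(r | P r) \sum_(x | Q x) F r x =
  \sum_(r | P r) \sum_(x | Q x) F (upd r (lab x) x) (r (lab x)).
Proof.
move=> h; rewrite !pair_big /=.
pose s (p : {ffun I -> V} * V) := (upd p.1 (lab p.2) p.2, p.1 (lab p.2)).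
have sK p : P p.1 && Q p.2 -> s (s p) = p.
  case: p => r x /= /andP[Pr Qx]; have [_ _ e] := h r x Pr Qx.
  by rewrite /s /= e updE upd_upd upd_id.
have sP p : P p.1 && Q p.2 -> P (s p).1 && Q (s p).2.
  by case: p => r x /= /andP[Pr Qx]; have [-> ->] := h r x Pr Qx.
rewrite (reindex_onto s s) => [|p /sK//]; apply: eq_bigl => p.
apply/idP/idP => [/andP[/sP hp /eqP e]|hp]; first by rewrite e in hp.
by rewrite sP // sK // eqxx.
Qed.

Definition degree (B : {set {ffun I -> V}}) i r := #|[set x | upd r i x \in B]|.

Lemma sum_degree B i : \sum_r degree B i r = #|V| * #|B|.
Proof.
rewrite /degree; under eq_bigr do rewrite card_sum_bool.
rewrite (@sum_swap (fun=> i) xpredT xpredT (fun r x => (upd r i x \in B : nat))) //.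
transitivity (\sum_r #|V| * (r \in B)).
  by apply: eq_bigr => r _; under eq_bigr do rewrite upd_upd upd_id; rewrite sum_nat_const.
by rewrite -big_distrr /= -card_sum_bool; congr (_ * _); apply: eq_card => r; rewrite inE.
Qed.

End Update.

Lemma leq_sub_ffact m T : (m - T) ^ T <= m ^_ T.
Proof.
rewrite ffact_prod -[X in _ ^ X]card_ord -prod_nat_const; apply: leq_prod => i _.
by rewrite leq_sub2l // ltnW.
Qed.

Section BlowUp.
Variables (I V : finType) (q T : nat).
Local Notation n := #|V|.
Hypotheses (q0 : 0 < q) (n_large : 4 * q * T.+1 <= n).

(** Many [r] have at least n/(2q) values at [i] leading into [B]; as n is large, at least n/(4q)
    remain after removing T values, so there are many injective T-tuples of such values. Averaging
    over all n^T tuples, one tuple serves a positive fraction of the [r]. *)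
Lemma blowup_coordinate (B : {set {ffun I -> V}}) i : n ^ #|I| <= q * #|B| ->
  exists2 w : {ffun 'I_T -> V}, injective w &
    n ^ #|I| <= 2 * q * (4 * q) ^ T * #|[set r | [forall t, upd r i (w t) \in B]]|.
Proof.
move=> hB; have n0 : 0 < n by apply: leq_trans n_large; rewrite !muln_gt0 q0.
have NE : n ^ #|I| = #|{ffun I -> V}| by rewrite card_ffun.
pose big := [set r | n <= 2 * q * degree B i r].
have hbig : n ^ #|I| <= 2 * q * #|big|.
  have h : 2 * q * (n * #|B|) <= 2 * q * #|big| * n + n ^ #|I| * n.
    rewrite -(sum_degree B i) big_distrr /= (bigID (mem big)) /=; apply: leq_add.
      rewrite -mulnA -sum_nat_const big_distrr /=; apply: leq_sum => r _.
      by rewrite leq_mul2l max_card orbT.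
    rewrite NE big_mkcond; apply: sum_bounded => r; case: ifP => //.
    by rewrite inE -ltnNge => /ltnW.
  rewrite -(leq_pmul2r n0); move: (leq_mul (leqnn (2 * n)) hB) h.
  by move: (n ^ _) => N; clear; lia.
pose cnt (w : {ffun 'I_T -> V}) := #|[set r | [forall t, upd r i (w t) \in B]]|.
have [/existsP[w /andP[/injectiveP wI hw]]|] :=
  boolP [exists w : {ffun 'I_T -> V}, injectiveb w && (n ^ #|I| <= 2 * q * (4 * q) ^ T * cnt w)].
  by exists w.
rewrite negb_exists => /forallP no; exfalso.
have : 2 * q * (4 * q) ^ T * \sum_(w : {ffun 'I_T -> V} | injectiveb w) cnt w <= n ^ T * (n ^ #|I|).-1.
  have -> : n ^ T = #|{ffun 'I_T -> V}| by rewrite card_ffun card_ord.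
  rewrite big_distrr /= big_mkcond; apply: sum_bounded => w.
  have := no w; case: (injectiveb w) => //=; rewrite -ltnNge => h.
  by rewrite -ltnS prednK // expn_gt0 n0.
have -> : \sum_(w : {ffun 'I_T -> V} | injectiveb w) cnt w = \sum_r degree B i r ^_ T.
  rewrite big_mkcond /=.
  transitivity (\sum_(w : {ffun 'I_T -> V}) #|[set r | injectiveb w && [forall t, upd r i (w t) \in B]]|).
    apply: eq_bigr => w _; case: (injectiveb w) => //.
    by rewrite eq_card0 // => r; rewrite !inE.
  rewrite double_count; apply: eq_bigr => r _.
  rewrite /degree -[X in _ ^_ X]card_ord -card_inj_ffuns_on; apply: eq_card => w.
  rewrite !inE andbC; congr (_ && _); apply/forallP/ffun_onP => h t; have := h t; by rewrite inE.
have : #|big| * n ^ T <= \sum_r (4 * q) ^ T * degree B i r ^_ T.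
  apply: markov => r; rewrite inE => h.
  apply: leq_trans (leq_mul (leqnn _) (leq_sub_ffact _ _)); rewrite -expnMn.
  have h' : n <= 4 * q * (degree B i r - T).
    move: n_large h; rewrite mulnBr; move: (degree _ _ _) (#|_|) => d N; clear.
    rewrite (_ : 4 * q * d = 2 * (2 * q * d)) ?mulnS; last by lia.
    by move: (2 * q * d) (4 * q * T) (4 * q) => a b c; lia.
  by case: (T) h' => // T' h'; rewrite leq_exp2r.
rewrite -big_distrr /=; set S := \sum_r _ => h1 h2.
have T0 : 0 < n ^ T by rewrite expn_gt0 n0.
have I0 : 0 < n ^ #|I| by rewrite expn_gt0 n0.
have h3 := leq_mul hbig (leqnn (n ^ T)).
have h4 := leq_mul (leqnn (2 * q)) h1.
have : n ^ T * n ^ #|I| <= n ^ T * (n ^ #|I|).-1.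
  apply: leq_trans h2; rewrite mulnC -mulnA; apply: leq_trans h4.
  by rewrite mulnA.
by rewrite leq_pmul2l // leqNgt prednK // leqnn.
Qed.
End BlowUp.

(** The tuples that a blow-up of coordinate [i] leaves in [B] again have positive density, with [q]
    replaced by 2q(4q)^T, so induction applies to them. Coordinates outside [s] stay frozen at
    [r]. *)
Lemma blowup_coordinates (I : finType) T (s : seq I) q : uniq s -> 0 < q -> exists n0,
  forall (V : finType) (B : {set {ffun I -> V}}), n0 <= #|V| -> #|V| ^ #|I| <= q * #|B| ->
  exists (w : I -> 'I_T -> V) (r : {ffun I -> V}), (forall i, i \in s -> injective (w i)) /\
    forall f : I -> 'I_T, [ffun i => if i \in s then w i (f i) else r i] \in B.
Proof.
elim: s q => [|i s IH] q.
  move=> _ q0; exists 1 => V B V0 hB.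
  have /card_gt0P[r rB] : 0 < #|B|.
    by rewrite lt0n; apply: contraTneq hB => ->; rewrite muln0 -ltnNge expn_gt0 V0.
  have /card_gt0P[x0 _] := V0.
  exists (fun _ _ => x0), r; split=> // f; rewrite (_ : [ffun _ => _] = r) //.
  by apply/ffunP => i; rewrite ffunE.
case/andP => si us q0.
have q'0 : 0 < 2 * q * (4 * q) ^ T by rewrite !muln_gt0 expn_gt0 muln_gt0 q0.
have [n0 hn0] := IH _ us q'0; exists (maxn n0 (4 * q * T.+1)) => V B.
rewrite geq_max => /andP[Vn0 Vn] hB.
have [wi wiI hwi] := @blowup_coordinate I V q T q0 Vn B i hB.
have [w [r [wI hw]]] := hn0 V _ Vn0 hwi.
exists (fun j => if j == i then (wi : _ -> _) else w j), r; split.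
  by move=> j; rewrite inE; case: eqP => [_ _|_ /= js]; [apply: wiI | apply: wI].
move=> f; have := hw f; rewrite inE => /forallP/(_ (f i)).
rewrite (_ : upd _ _ _ = [ffun j => if j \in i :: s
    then (if j == i then (wi : _ -> _) else w j) (f j) else r j]) //.
by apply/ffunP => j; rewrite !ffunE inE; case: eqP => [->|].
Qed.

(* The Kovari-Sos-Turan-Erdos theorem. *)
Lemma dense_contains_box (I : finType) T q : 0 < q -> exists n0,
  forall (V : finType) (B : {set {ffun I -> V}}), n0 <= #|V| -> #|V| ^ #|I| <= q * #|B| ->
  exists w : I -> 'I_T -> V, (forall i, injective (w i)) /\
    forall f : I -> 'I_T, [ffun i => w i (f i)] \in B.
Proof.
move=> q0; have [n0 h] := blowup_coordinates T (enum_uniq I) q0; exists n0 => V B Vn hB.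
have [w [r [wI hw]]] := h V B Vn hB; exists w; split=> [i|f].
  by apply: wI; rewrite mem_enum.
rewrite (_ : [ffun _ => _] = [ffun i => if i \in enum I then w i (f i) else r i]) //.
by apply/ffunP => i; rewrite !ffunE mem_enum.
Qed.

(** * Random representatives *)

Lemma oedges_symdiff (T : finType) (E E' : {set {set T}}) :
  #|(oedges E :\: oedges E') :|: (oedges E' :\: oedges E)| =
  triple_count (fun x y z => edge E x y z != edge E' x y z).
Proof.
rewrite -card_triple_set; apply: eq_card => t; rewrite !inE /= /edge.
by case: (_ \in E); case: (_ \in E').
Qed.

Section Representatives.
Variables (V Lab : finType) (E : {set {set V}}) (lab : V -> Lab) (good : pred Lab) (v : nat).
Local Notation n := #|V|.
Local Notation e := (edge E).
Implicit Type r : {ffun Lab -> V}.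

(** At labels that are not good the value is arbitrary, so that a system is a total map even if
    blocks are empty. *)
Definition rep_system : pred {ffun Lab -> V} :=
  fun r => [forall l, good l ==> (lab (r l) == l)].

Definition transverse x y z :=
  [&& good (lab x), good (lab y), good (lab z),
      lab x != lab y, lab x != lab z & lab y != lab z].

Definition reduced r : {set {set Lab}} :=
  [set S : {set Lab} | [&& S \subset [set l | good l], #|S| == 3 & r @: S \in E]].

Definition pullback (R : {set {set Lab}}) : {set {set V}} :=
  [set S : {set V} | (#|S| == 3) && (lab @: S \in R)].

Lemma rep_systemP r l : rep_system r -> good l -> lab (r l) = l.
Proof. by move=> /forallP/(_ l)/implyP h /h/eqP. Qed.

Lemma cards3 (T : finType) (x y z : T) :
  (#|[set x; y; z]| == 3) = [&& x != y, x != z & y != z].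
Proof.
by rewrite -setUA !cardsU1 !inE cards1; case: (x == y); case: (x == z); case: (y == z).
Qed.

Lemma edge_reduced r x y z : transverse x y z ->
  edge (reduced r) (lab x) (lab y) (lab z) = e (r (lab x)) (r (lab y)) (r (lab z)).
Proof.
case/and5P => gx gy gz nxy /andP[nxz nyz].
rewrite /edge inE cards3 nxy nxz nyz !imsetU !imset_set1 /=.
by rewrite !subUset !sub1set !inE gx gy gz.
Qed.

Lemma reduced3 r : is3graph (reduced r).
Proof. by move=> S; rewrite inE => /and3P[_ /eqP]. Qed.

Lemma reduced_good r l l' l'' : edge (reduced r) l l' l'' -> [/\ good l, good l' & good l''].
Proof. by rewrite /edge inE => /andP[]; rewrite !subUset !sub1set !inE => /andP[/andP[]]. Qed.

Lemma edge_pullback R x y z : is3graph R ->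
  edge (pullback R) x y z = edge R (lab x) (lab y) (lab z).
Proof.
move=> R3; rewrite /edge inE cards3 !imsetU !imset_set1 /=.
case h: (_ \in R); rewrite ?andbF // andbT.
have [] := edge_neq R3 h => h1 h2 h3.
by apply/and3P; split; [apply: contraNneq h1|apply: contraNneq h2|apply: contraNneq h3] => ->.
Qed.

(** The labels of a shattered configuration are shattered in [R], because [edge_pullback] holds for
    all triples, including those that meet a block twice. *)
Lemma pullback_VC R k : is3graph R -> VC_ge (pullback R) k -> VC_ge R k.
Proof.
move=> R3 [a [b [c h]]]; exists (fun i => lab (a i)), (fun i => lab (b i)), (fun S => lab (c S)).
by move=> i S; rewrite -h; symmetry; apply: edge_pullback.
Qed.

Definition rep_error r := triple_count (fun x y z =>
  transverse x y z && (e x y z != e (r (lab x)) (r (lab y)) (r (lab z)))).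

(** Exchanging [x] with its representative keeps the label, hence preserves [rep_system] and
    [transverse]. It alters [r], which is why only the sum over all systems is invariant. *)
Lemma sum_swap_fst (H : {ffun Lab -> V} -> V -> V -> V -> bool) :
  \sum_(r | rep_system r) triple_count (fun x y z => transverse x y z && H r x y z) =
  \sum_(r | rep_system r) triple_count (fun x y z =>
    transverse x y z && H (upd r (lab x) x) (r (lab x)) y z).
Proof.
pose F r x := \sum_y \sum_z (transverse x y z && H r x y z : nat).
have restrict (F' : V -> nat) : (forall x, ~~ good (lab x) -> F' x = 0) ->
    \sum_x F' x = \sum_(x | good (lab x)) F' x.
  move=> h; rewrite [RHS]big_mkcond; apply: eq_bigr => x _.
  by case: ifP => // /negbT/h.
have nt x y z : ~~ good (lab x) -> transverse x y z = false by rewrite /transverse => /negbTE->.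
transitivity (\sum_(r | rep_system r) \sum_(x | good (lab x)) F r x).
  apply: eq_bigr => r _; apply: restrict => x gx.
  by rewrite big1 // => y _; rewrite big1 // => z _; rewrite nt.
rewrite (@sum_swap _ _ lab rep_system (fun x => good (lab x)) F); last first.
  move=> r x hr gx; have e1 := rep_systemP hr gx; split=> //; last by rewrite e1.
  apply/forallP => l; apply/implyP => gl; rewrite ffunE.
  by have [->|_] := eqVneq l (lab x); rewrite ?(rep_systemP hr gl).
apply: eq_bigr => r hr; rewrite [RHS]restrict => [|x gx]; last first.
  by rewrite big1 // => y _; rewrite big1 // => z _; rewrite nt.
apply: eq_bigr => x gx; apply: eq_bigr => y _; apply: eq_bigr => z _.
by rewrite /transverse (rep_systemP hr gx).
Qed.

Lemma transverse_sym12 x y z : transverse x y z = transverse y x z.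
Proof.
rewrite /transverse (eq_sym (lab y) (lab x)); case: (good _); case: (good _); case: (good _) => //=.
by case: (lab x == lab y); case: (lab x == lab z); case: (lab y == lab z).
Qed.

Lemma transverse_sym23 x y z : transverse x y z = transverse x z y.
Proof.
rewrite /transverse (eq_sym (lab z) (lab y)); case: (good _); case: (good _); case: (good _) => //=.
by case: (lab x == lab y); case: (lab x == lab z); case: (lab y == lab z).
Qed.

Hypothesis block_close : forall x x', good (lab x) -> lab x = lab x' ->
  v * #|link_diff e x x'| <= 9 * (n * n).

Let err1 r x y z := transverse x y z && (e x y z != e (r (lab x)) y z).

Lemma err1_count r : rep_system r -> v * triple_count (err1 r) <= 9 * n ^ 3.
Proof.
move=> hr; rewrite (_ : 9 * n ^ 3 = n * (9 * (n * n))); last by rewrite !expnS expn0; clear; lia.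
rewrite /triple_count big_distrr /=; apply: sum_bounded => x.
case gx: (good (lab x)); last first.
  by rewrite big1 ?muln0 // => y _; rewrite big1 // => z _; rewrite /err1 /transverse gx.
apply: leq_trans (block_close (x' := r (lab x)) gx _); last by rewrite (rep_systemP hr gx).
rewrite leq_mul2l (card_pairs (fun y z => e x y z != e (r (lab x)) y z)); apply/orP; right.
apply: leq_sum => y _; rewrite card_sum_bool; apply: leq_sum => z _.
by rewrite /err1; case: transverse.
Qed.

(* Replace x, y, z by their representatives one at a time; in the last two steps the already
   replaced coordinates are swapped back with their representatives. *)
Lemma sum_rep_error :
  v * \sum_(r | rep_system r) rep_error r <= 27 * n ^ 3 * \sum_(r | rep_system r) 1.
Proof.
pose err2 r x y z := transverse x y z && (e (r (lab x)) y z != e (r (lab x)) (r (lab y)) z).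
pose err3 r x y z := transverse x y z &&
  (e (r (lab x)) (r (lab y)) z != e (r (lab x)) (r (lab y)) (r (lab z))).
have h1 : \sum_(r | rep_system r) rep_error r <= \sum_(r | rep_system r) triple_count (err1 r) +
    \sum_(r | rep_system r) triple_count (err2 r) + \sum_(r | rep_system r) triple_count (err3 r).
  rewrite -!big_split; apply: leq_sum => r _ /=; rewrite /triple_count -!big_split.
  apply: leq_sum => x _ /=; rewrite -!big_split; apply: leq_sum => y _ /=.
  rewrite -!big_split; apply: leq_sum => z _ /=; rewrite /err1 /err2 /err3.
  case: transverse => //=; case: (e x y z); case: (e (r (lab x)) y z);
    by case: (e (r (lab x)) (r (lab y)) z); case: (e (r (lab x)) (r (lab y)) (r (lab z))).
have sw x y z r : rep_system r -> transverse x y z ->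
    [/\ upd r (lab x) x (lab (r (lab x))) = x, upd r (lab x) x (lab y) = r (lab y) &
        upd r (lab x) x (lab z) = r (lab z)].
  move=> hr /and5P[gx gy gz nxy /andP[nxz nyz]].
  by rewrite (rep_systemP hr gx) updE !upd_neq // eq_sym.
(* Once [x] and its representative have traded places, the comparison is between [e x y z] and
   [e x (r (lab y)) z]: this is [err1] with the first two coordinates exchanged. *)
have h2 : \sum_(r | rep_system r) triple_count (err2 r) =
    \sum_(r | rep_system r) triple_count (err1 r).
  rewrite (sum_swap_fst (fun r x y z => e (r (lab x)) y z != e (r (lab x)) (r (lab y)) z)).
  apply: eq_bigr => r hr; rewrite -[RHS]triple_count_swap12; apply: eq_bigr => x _.
  apply: eq_bigr => y _; apply: eq_bigr => z _; rewrite /err1 (transverse_sym12 y x z).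
  case tr: (transverse x y z) => //=; have [-> -> _] := sw _ _ _ _ hr tr.
  by rewrite edge_sym12 [e x (r _) z]edge_sym12.
have h3 : \sum_(r | rep_system r) triple_count (err3 r) =
    \sum_(r | rep_system r) triple_count (err1 r).
  rewrite (sum_swap_fst (fun r x y z =>
    e (r (lab x)) (r (lab y)) z != e (r (lab x)) (r (lab y)) (r (lab z)))).
  transitivity (\sum_(r | rep_system r) triple_count (fun y x z => transverse y x z &&
      (e x (r (lab y)) z != e x (r (lab y)) (r (lab z))))).
    apply: eq_bigr => r hr; rewrite -[RHS]triple_count_swap12; apply: eq_bigr => x _.
    apply: eq_bigr => y _; apply: eq_bigr => z _; rewrite (transverse_sym12 y x z).
    by case tr: (transverse x y z) => //=; have [-> -> ->] := sw _ _ _ _ hr tr.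
  rewrite (sum_swap_fst (fun r y x z => e x (r (lab y)) z != e x (r (lab y)) (r (lab z)))).
  apply: eq_bigr => r hr; rewrite -[RHS]triple_count_rot; apply: eq_bigr => y _.
  apply: eq_bigr => x _; apply: eq_bigr => z _; rewrite /err1.
  rewrite (transverse_sym12 z y x) (transverse_sym23 y z x).
  case tr: (transverse y x z) => //=; have [-> _ ->] := sw _ _ _ _ hr tr.
  have es a : e a y x = e x y a by rewrite edge_sym12 edge_sym23 edge_sym12.
  by rewrite !es.
apply: leq_trans (leq_mul (leqnn v) h1) _; rewrite h2 h3.
have h4 : v * \sum_(r | rep_system r) triple_count (err1 r) <= \sum_(r | rep_system r) 9 * n ^ 3.
  by rewrite big_distrr; apply: leq_sum => r hr; apply: err1_count.
rewrite !mulnDr; apply: leq_trans (leq_add (leq_add h4 h4) h4) _.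
have -> : \sum_(r | rep_system r) 9 * n ^ 3 = 9 * n ^ 3 * \sum_(r | rep_system r) 1.
  by rewrite big_distrr /=; apply: eq_bigr => r _; rewrite muln1.
by move: (n ^ 3) (\sum_(r | _) 1) => a b; clear; lia.
Qed.

Hypothesis few_bad : v * #|[set x | ~~ good (lab x)]| <= 3 * n.
Hypothesis small_blocks : forall l, good l -> v * #|block lab l| <= 2 * n.

(** One of three vertices is bad or one of three pairs shares a good label: 15 = 3 * 3 + 3 * 2. *)
Lemma nontransverse_count : v * triple_count (fun x y z => ~~ transverse x y z) <= 15 * n ^ 3.
Proof.
pose G := [set x | ~~ good (lab x)].
pose same x y := good (lab x) && (lab x == lab y).
have hG : v * triple_count (fun x _ _ => x \in G) <= 3 * n ^ 3.
  rewrite triple_count_fst mulnA (_ : 3 * n ^ 3 = 3 * n * (n * n)).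
    by rewrite leq_mul2r few_bad orbT.
  by rewrite !expnS expn0; clear; lia.
have hs : v * triple_count (fun x y _ => same x y) <= 2 * n ^ 3.
  rewrite (_ : 2 * n ^ 3 = n * (2 * n * n)); last by rewrite !expnS expn0; clear; lia.
  rewrite /triple_count big_distrr; apply: sum_bounded => x /=.
  under eq_bigr do rewrite sum_nat_const; rewrite -big_distrr /= mulnCA mulnC leq_mul2r.
  case gx: (good (lab x)); last first.
    by rewrite big1 ?muln0 ?orbT // => y _; rewrite /same gx.
  apply/orP; right; apply: leq_trans (small_blocks gx); rewrite leq_mul2l card_sum_bool.
  by apply/orP; right; apply: leq_sum => y _; rewrite /same gx eq_sym.
have : triple_count (fun x y z => ~~ transverse x y z) <=
    3 * triple_count (fun x _ _ => x \in G) + 3 * triple_count (fun x y _ => same x y).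
  have -> : 3 * triple_count (fun x y _ => same x y) = triple_count (fun x y _ => same x y) +
      triple_count (fun x _ y => same x y) + triple_count (fun _ x y => same x y).
    rewrite (triple_count_swap23 (fun x y _ => same x y)).
    rewrite -(triple_count_rot (fun _ x y => same x y)).
    by rewrite !mulSn addn0 addnA.
  have -> : 3 * triple_count (fun x _ _ => x \in G) = triple_count (fun x _ _ => x \in G) +
      triple_count (fun _ x _ => x \in G) + triple_count (fun _ _ x => x \in G).
    rewrite (triple_count_swap12 (fun x _ _ => x \in G)).
    by rewrite (triple_count_rot (fun x _ _ => x \in G)) !mulSn addn0 addnA.
  rewrite /triple_count -!big_split; apply: leq_sum => x _ /=.
  rewrite -!big_split; apply: leq_sum => y _ /=; rewrite -!big_split; apply: leq_sum => z _ /=.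
  rewrite /transverse /same !inE; case: (good (lab x)); case: (good (lab y)); case: (good (lab z));
    rewrite //= ?addnS //.
  by case: (lab x == lab y); case: (lab x == lab z); case: (lab y == lab z).
move=> h; apply: leq_trans (leq_mul (leqnn v) h) _; rewrite mulnDr mulnCA [v * (3 * _)]mulnCA.
have := leq_add (leq_mul (leqnn 3) hG) (leq_mul (leqnn 3) hs); move/leq_trans; apply.
by move: (n ^ 3) => a; clear; lia.
Qed.

(** The bound 54 is twice the average 27 of [sum_rep_error], so at least half of the systems meet
    it; 69 = 54 + 15. *)
Lemma pullback_close r : v * rep_error r <= 54 * n ^ 3 ->
  v * #|(oedges E :\: oedges (pullback (reduced r))) :|:
        (oedges (pullback (reduced r)) :\: oedges E)| <= 69 * n ^ 3.
Proof.
move=> hr; set E' := pullback _.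
rewrite oedges_symdiff.
have : triple_count (fun x y z => e x y z != edge E' x y z) <=
    rep_error r + triple_count (fun x y z => ~~ transverse x y z).
  rewrite /rep_error /triple_count -!big_split; apply: leq_sum => x _ /=.
  rewrite -!big_split; apply: leq_sum => y _ /=; rewrite -!big_split; apply: leq_sum => z _ /=.
  case tr: transverse; last by case: (_ != _).
  by rewrite edge_pullback ?edge_reduced //=; [case: (_ != _) | apply: reduced3].
move/(leq_mul (leqnn v))/leq_trans; apply; rewrite mulnDr.
apply: leq_trans (leq_add hr nontransverse_count) _.
by rewrite -mulnDl.
Qed.

End Representatives.

(** * Blow-ups of shattered configurations *)

Lemma card_residue n v i : 0 < v -> v * #|[set x : 'I_n | x %% v == i]| <= n + v.
Proof.
move=> v0; have h : #|[set x : 'I_n | x %% v == i]| <= (n %/ v).+1.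
  rewrite -[X in _ <= X]card_ord -(card_in_imset (f := fun x : 'I_n => inord (x %/ v) : 'I_(n %/ v).+1)).
    exact: max_card.
  have lt (x : 'I_n) : x %/ v < (n %/ v).+1 by rewrite ltnS leq_div2r // ltnW.
  move=> x y; rewrite !inE => /eqP mx /eqP my /(congr1 val) /=; rewrite !inordK // => dxy.
  by apply: val_inj; rewrite /= (divn_eq x v) (divn_eq y v) dxy mx my.
apply: leq_trans (leq_mul (leqnn v) h) _.
by rewrite mulnS addnC leq_add2r mulnC leq_divM.
Qed.

Lemma pigeonhole (T U : finType) (A : {set T}) (f : T -> U) : 0 < #|A| ->
  exists u, #|A| <= #|U| * #|[set x in A | f x == u]|.
Proof.
move=> A0; have /card_gt0P[x0 _] := A0.
have [/existsP[u hu]|] := boolP [exists u, #|A| <= #|U| * #|[set x in A | f x == u]|]; first by exists u.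
rewrite negb_exists => /forallP no; exfalso.
have U0 : 0 < #|U| by apply/card_gt0P; exists (f x0).
have : #|U| * #|A| <= #|U| * #|A|.-1; last by rewrite leq_pmul2l // leqNgt prednK // leqnn.
rewrite -{1}sum1_card (partition_big f xpredT) //= big_distrr /=; apply: sum_bounded => u.
have h := no u; rewrite -ltnNge in h; rewrite -ltnS prednK //; apply: leq_trans h.
rewrite ltnS leq_mul2l; apply/orP; right; rewrite -sum1_card.
by apply: eq_leq; apply: eq_bigl => x; rewrite inE.
Qed.

Lemma close_or_box k K T v : 0 < k -> 0 < v ->
  (exists N, forall (P : prop3) n (E : {set {set 'I_n}}), ~ in_Trip P (kUk k) -> P n E -> N <= n ->
    exists (g : 'I_n -> label_type v) (G : {set 'I_n}), v * #|G| <= 2 * n /\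
      forall x x', x \notin G -> x' \notin G -> g x = g x' ->
        v * #|link_diff (edge E) x x'| <= 9 * (n * n)) ->
  exists N, forall (P : prop3) n (E : {set {set 'I_n}}), ~ in_Trip P (kUk k) -> P n E -> N <= n ->
  (exists E' : {set {set 'I_n}}, [/\ is3graph E', ~ VC_ge E' K &
     v * #|(oedges E :\: oedges E') :|: (oedges E' :\: oedges E)| <= 69 * n ^ 3]) \/
  (exists (Lab : finType) (lab : 'I_n -> Lab) (good : pred Lab) (R : {set {set Lab}})
     (w : Lab -> 'I_T -> 'I_n), [/\ VC_ge R K, forall l, injective (w l) &
     forall f : Lab -> 'I_T, let r := [ffun l => w l (f l)] in
       rep_system lab good r /\ reduced E good r = R]).
Proof.
move=> k0 v0 [N0 hN0].
pose Lab := option (label_type v * 'I_v).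
pose Q := #|{: Lab}|; pose M := #|{: {set {set Lab}}}|.
have Q0 : 0 < Q by rewrite /Q card_option.
have M0 : 0 < M by apply/card_gt0P; exists set0.
pose gam := v * Q; have gam0 : 0 < gam by rewrite muln_gt0 v0.
(* The factor gam^Q compares all maps with the representative systems, 2 keeps those of small error,
   and [M] pays for fixing the reduced 3-graph. None of them depends on n. *)
have q0 : 0 < gam ^ Q * (2 * M) by rewrite !muln_gt0 expn_gt0 gam0.
have [N1 hN1] := dense_contains_box Lab T q0.
exists (maxn 1 (maxn v (maxn N0 N1))) => P n E nT PE.
rewrite !geq_max => /and4P[n0 nv nN0 nN1].
have [g [G [hG hg]]] := hN0 P n E nT PE nN0.
(* The residue mod [v] only serves to make blocks small: triples with two vertices in one block are
   nonedges of every pullback and must be negligible. *)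
pose lab x : Lab := if x \in G then None else Some (g x, Ordinal (ltn_pmod x v0)).
have labG x : isSome (lab x) = (x \notin G) by rewrite /lab; case: (x \in G).
(* Blocks below n / gam together cover at most n/v vertices. Dropping them gives the representative
   systems density at least gam^-Q among all maps, as needed to find a box. *)
pose good (l : Lab) := isSome l && (n <= gam * #|block lab l|).
have cn : #|'I_n| = n := card_ord n.
have close x x' : good (lab x) -> lab x = lab x' ->
    v * #|link_diff (edge E) x x'| <= 9 * (#|'I_n| * #|'I_n|).
  case/andP => gx _ exx'; have gx' : isSome (lab x') by rewrite -exx'.
  move: gx gx'; rewrite !labG cn => gx gx'; apply: hg => //.
  by move: exx'; rewrite /lab (negbTE gx) (negbTE gx') => -[].
have few : v * #|[set x | ~~ good (lab x)]| <= 3 * #|'I_n|.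
  pose small := [set x | gam * #|block lab (lab x)| < n].
  have hs : v * #|small| <= n.
    rewrite -(leq_pmul2l Q0) mulnA [Q * v]mulnC -/gam card_sum_bool.
    rewrite (sum_block_const lab (fun l => (gam * #|block lab l| < n : nat))) big_distrr /=.
    apply: sum_bounded => l; case: ltnP => [/ltnW|_]; first by rewrite muln1.
    by rewrite !muln0.
  rewrite cn; apply: leq_trans (_ : v * #|G :|: small| <= _).
    rewrite leq_mul2l; apply/orP; right; apply: subset_leq_card; apply/subsetP => x.
    by rewrite !inE /good labG negb_and negbK -ltnNge.
  apply: leq_trans (leq_mul (leqnn v) (leq_card_setU _ _)) _; rewrite mulnDr.
  by rewrite (_ : 3 * n = 2 * n + n) ?leq_add // -[X in _ + X]mul1n -mulnDl.
have smallb l : good l -> v * #|block lab l| <= 2 * #|'I_n|.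
  case: l => [[l i]|] // _; rewrite cn; apply: leq_trans (_ : n + v <= _).
    apply: leq_trans (card_residue n i v0); rewrite leq_mul2l; apply/orP; right.
    apply: subset_leq_card; apply/subsetP => x; rewrite !inE /lab.
    by case: (x \in G) => // /eqP[_ <-].
  by rewrite mul2n -addnn leq_add2l.
have herr := sum_rep_error close; rewrite cn in herr.
set F := \sum_(r | rep_system lab good r) 1 in herr.
pose Bs := [set r : {ffun Lab -> 'I_n} | rep_system lab good r && (v * rep_error E lab good r <= 54 * n ^ 3)].
have n30 : 0 < 27 * n ^ 3 by rewrite muln_gt0 expn_gt0 n0.
have FB : F <= 2 * #|Bs|.
  pose Bd := [set r : {ffun Lab -> 'I_n} | rep_system lab good r && (54 * n ^ 3 < v * rep_error E lab good r)].
  have FE : F = #|Bs| + #|Bd|.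
    rewrite /F (bigID (fun r => v * rep_error E lab good r <= 54 * n ^ 3)) /= -!sum1_card.
    by congr (_ + _); apply: eq_bigl => r; rewrite inE // -ltnNge.
  have : #|Bd| * (2 * (27 * n ^ 3)) <= 27 * n ^ 3 * F.
    apply: leq_trans herr; rewrite big_distrr /= [X in _ <= X]big_mkcond (mulnA 2 27); apply: markov => r.
    by rewrite inE => /andP[-> /ltnW].
  rewrite [X in X <= _](_ : _ = 27 * n ^ 3 * (2 * #|Bd|)); last by rewrite mulnC -mulnA mulnCA.
  by rewrite leq_pmul2l // FE; move: (#|Bs|) (#|Bd|) => a b; clear; lia.
have FL : n ^ Q <= gam ^ Q * F.
  pose Fm l := if good l then block lab l else [set: 'I_n].
  apply: leq_trans (_ : gam ^ Q * #|family (fun l => Fm l)| <= _).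
    rewrite card_family_prod -!prod_nat_const -big_split /=; apply: leq_prod => l _.
    rewrite /Fm; case: ifP => [/andP[_] //|_].
    by rewrite cardsT cn leq_pmull.
  rewrite leq_mul2l /F sum1_card; apply/orP; right; apply: subset_leq_card.
  apply/subsetP => r /familyP h; apply/forallP => l; apply/implyP => gl.
  by have := h l; rewrite /Fm gl inE.
have Bs0 : 0 < #|Bs|.
  rewrite lt0n; apply: contraTneq FL => Bs0; rewrite Bs0 muln0 leqn0 in FB.
  by rewrite (eqP FB) muln0 -ltnNge expn_gt0 n0.
have [[r [rB nVC]]|allVC] := classic (exists r, r \in Bs /\ ~ VC_ge (reduced E good r) K).
  left; exists (pullback lab (reduced E good r)); split.
  - by move=> S; rewrite inE => /andP[/eqP].
  - by move/pullback_VC => h; apply: nVC; apply: h; apply: reduced3.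
  have := @pullback_close _ _ E lab good v few smallb r; rewrite cn; apply.
  by move: rB; rewrite inE => /andP[].
right; have [R hR] := pigeonhole (reduced E good) Bs0.
have hbox : #|'I_n| ^ #|{: Lab}| <= gam ^ Q * (2 * M) * #|[set r in Bs | reduced E good r == R]|.
  rewrite cn; apply: leq_trans FL _; rewrite -mulnA leq_mul2l; apply/orP; right.
  by apply: leq_trans FB _; rewrite -mulnA leq_mul2l.
have VN1 : N1 <= #|'I_n| by rewrite cn.
have [w [wI hw]] := hN1 _ _ VN1 hbox.
exists Lab, lab, good, R, w; split=> // [|f].
  have /card_gt0P[r] : 0 < #|[set r in Bs | reduced E good r == R]|.
    by rewrite lt0n; apply: contraTneq hR => ->; rewrite muln0 -ltnNge.
  rewrite inE => /andP[rB /eqP <-]; apply: NNPP => h; apply: allVC; by exists r.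
by have := hw f; rewrite !inE => /andP[/andP[? _] /eqP].
Qed.

(** In [VC_ge] the vertex c_S may equal a_i or b_i when i is not in S, and c of the empty set may
    lie in no edge. The m + 1 additional coordinates offer 2^(m+1) - 1 > 2m nonempty extensions of
    S: one of them avoids all a_i and b_i, and any of its new coordinates provides an edge. *)
Lemma VC_ge_nondegenerate (T : finType) (R : {set {set T}}) m : is3graph R ->
  VC_ge R (m + m.+1) -> exists (a b : 'I_m -> T) (c : {set 'I_m} -> T),
  [/\ forall i S, edge R (a i) (b i) (c S) = (i \in S),
      forall i S, c S != a i /\ c S != b i & forall S, exists x y, edge R x y (c S)].
Proof.
move=> R3 [a [b [c h]]].
have h' i S : edge R (a i) (b i) (c S) = (i \in S) by apply: h.
have cI : injective c by move=> S S' e; apply/setP => i; rewrite -!h' e.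
pose ext (S : {set 'I_m}) (U : {set 'I_m.+1}) := (lshift m.+1 @: S) :|: (@rshift m m.+1 @: U).
have extL S U i : (lshift m.+1 i \in ext S U) = (i \in S).
  rewrite in_setU mem_imset; last exact: lshift_inj.
  rewrite [X in _ || X](_ : _ = false) ?orbF //.
  by apply/imsetP => -[j _ /eqP]; rewrite eq_shift.
have extR S U i : (rshift m i \in ext S U) = (i \in U).
  rewrite in_setU [X in _ || X]mem_imset; last exact: rshift_inj.
  rewrite [X in X || _](_ : _ = false) //.
  by apply/imsetP => -[j _ /eqP]; rewrite eq_shift.
pose bad := (a \o lshift m.+1) @: [set: 'I_m] :|: (b \o lshift m.+1) @: [set: 'I_m].
have bad2 : #|bad| <= 2 * m.
  apply: leq_trans (leq_card_setU _ _) _; rewrite mul2n -addnn.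
  by apply: leq_add; apply: leq_trans (leq_imset_card _ _) _; rewrite cardsT card_ord.
have ex S : exists U, (U != set0) && (c (ext S U) \notin bad).
  apply/existsP; rewrite -[X in is_true X]negbK negb_exists; apply/negP => /forallP no.
  have : #|[set~ (set0 : {set 'I_m.+1})]| <= #|bad|.
    rewrite -(card_in_imset (f := fun U => c (ext S U))).
      apply: subset_leq_card; apply/subsetP => x /imsetP[U]; rewrite in_setC1 => U0 ->.
      by have := no U; rewrite U0 negbK.
    by move=> U U' _ _ /cI /setP e; apply/setP => i; have := e (rshift m i); rewrite !extR.
  rewrite cardsC1 card_set_type card_ord => /leq_trans/(_ bad2); apply/negP.
  rewrite -ltnNge expnS; have := ltn_expl m (isT : 1 < 2); move: (2 ^ m) => x; clear; lia.
pose U S := xchoose (ex S).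
exists (a \o lshift m.+1), (b \o lshift m.+1), (fun S => c (ext S (U S))).
have hU S : (U S != set0) && (c (ext S (U S)) \notin bad) := xchooseP (ex S).
split=> [i S|i S|S] /=.
- by rewrite h' extL.
- have /andP[_] := hU S; rewrite inE negb_or => /andP[h1 h2]; split.
    by apply: contraNneq h1 => ->; apply/imsetP; exists i.
  by apply: contraNneq h2 => ->; apply/imsetP; exists i.
have /andP[/set0Pn[j jU] _] := hU S.
by exists (a (rshift m j)), (b (rshift m j)); rewrite h' extR.
Qed.

(** The sizes are chosen so that the A_i, the B_i and the C_S each have m * 2^m * s vertices in
    total; [s] makes the blow-up as large as desired. *)
Definition blowup_vert m s : finType :=
  ('I_m * 'I_(2 ^ m * s) + 'I_m * 'I_(2 ^ m * s) + {set 'I_m} * 'I_(m * s))%type.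

(** Only the triples in A_i x B_i x C_S, with the same i twice, are prescribed. *)
Definition blowup m s (T : finType) (E : {set {set T}}) (h : blowup_vert m s -> T) :=
  injective h /\ forall i u u' S t,
    edge E (h (inl (inl (i, u)))) (h (inl (inr (i, u')))) (h (inr (S, t))) = (i \in S).

(** The side of the box is the number of all blow-up vertices. Each vertex thus has a slot of its
    own, and coincidences such as a_i = b_j do not spoil injectivity. *)
Lemma box_blowup m s (V Lab : finType) (E : {set {set V}}) (lab : V -> Lab) (good : pred Lab)
  (R : {set {set Lab}}) (w : Lab -> 'I_#|blowup_vert m s| -> V) :
  VC_ge R (m + m.+1) -> (forall l, injective (w l)) ->
  (forall f, let r := [ffun l => w l (f l)] in rep_system lab good r /\ reduced E good r = R) ->
  exists h : blowup_vert m s -> V, blowup E h.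
Proof.
move=> VCR wI hw.
(* The vertex type is empty when [m] or [s] is 0. *)
have [[d0 _]|nD] := classic (exists d : blowup_vert m s, True); last first.
  have h (d : blowup_vert m s) : V by case: nD; exists d.
  exists h; split; first by move=> d; case: nD; exists d.
  by move=> i u u' S t; case: nD; exists (inr (S, t)).
have RE : R = reduced E good [ffun l => w l (enum_rank d0)] by have [] := hw (fun=> enum_rank d0).
have R3 : is3graph R by rewrite RE; apply: reduced3.
have [a [b [c [h1 h2 h3]]]] := VC_ge_nondegenerate R3 VCR.
have gR x y z : edge R x y z -> [/\ good x, good y & good z] by rewrite RE; apply: reduced_good.
have gc S : good (c S) by have [x [y /gR[]]] := h3 S.
have gab i : good (a i) /\ good (b i).
  by have /gR[] : edge R (a i) (b i) (c setT) by rewrite h1 inE.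
have nab i : a i != b i.
  by have /(edge_neq R3)[] : edge R (a i) (b i) (c setT) by rewrite h1 inE.
have labw l t : good l -> lab (w l t) = l.
  move=> gl; have [/rep_systemP/(_ gl) h _] := hw (fun=> t).
  by move: h; rewrite ffunE.
pose vert (d : blowup_vert m s) := match d with
  | inl (inl (i, _)) => a i | inl (inr (i, _)) => b i | inr (X, _) => c X end.
have gv d : good (vert d) by case: d => [[[i u]|[i u]]|[S t]] //=; have [] := gab i.
pose h d := w (vert d) (enum_rank d); exists h; split.
  move=> d d' e; have ev : vert d = vert d'.
    by rewrite -(labw _ (enum_rank d) (gv d)) -(labw _ (enum_rank d') (gv d')) -/(h d) e.
  by move: e; rewrite /h ev => /wI/enum_rank_inj.
move=> i u u' S t; set d1 : blowup_vert m s := inl (inl _); set d2 : blowup_vert m s := inl (inr _).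
set d3 : blowup_vert m s := inr _; have [nca ncb] := h2 i S.
(* Since a_i, b_i and c_S are distinct labels, one system of the box represents them by the three
   vertices under consideration. *)
pose f l := if l == a i then enum_rank d1 else if l == b i then enum_rank d2 else enum_rank d3.
have [hr eR] := hw f; set r := [ffun l => _] in hr eR.
have tr : transverse lab good (h d1) (h d2) (h d3).
  rewrite /transverse /h !labw ?gv //= nab.
  by rewrite (eq_sym (a i) (c S)) nca (eq_sym (b i) (c S)) ncb.
have := edge_reduced E r tr; rewrite eR /h !labw ?gv //= h1 => ->.
rewrite !ffunE /f eqxx eq_sym (negbTE (nab i)) eqxx (negbTE nca) (negbTE ncb).
by [].
Qed.

Lemma VC_ge_leq (T : finType) (E : {set {set T}}) k k' : k' <= k -> VC_ge E k -> VC_ge E k'.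
Proof.
move=> kk [a [b [c h]]]; pose wd := widen_ord kk.
exists (a \o wd), (b \o wd), (fun S : {set 'I_k'} => c (wd @: S)) => i S; rewrite h.
by apply: mem_imset => x y /(congr1 val)/= /val_inj.
Qed.

Definition bounded_VC K : prop3 := fun n E => is3graph E /\ ~ VC_ge E K.

Lemma bounded_VC_hereditary K : hereditary (bounded_VC K).
Proof.
split=> [n E []//|m n f E fI [E3 nVC]]; split.
  by move=> S; rewrite inE => /E3; rewrite card_imset.
case=> a [b [c h]]; apply: nVC; exists (f \o a), (f \o b), (f \o c) => i S.
by rewrite -h inE !imsetU !imset_set1.
Qed.

Lemma bounded_VC_finite K : finite_VC (bounded_VC K).
Proof.
exists K => n E k [_ nVC] hk; rewrite leqNgt; apply/negP => /ltnW lt.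
exact/nVC/VC_ge_leq/hk.
Qed.

Lemma far_blowup k P m s : 0 < k -> hereditary P -> ~ in_Trip P (kUk k) -> far_from_finite_VC P ->
  exists n (E : {set {set 'I_n}}) (h : blowup_vert m s -> 'I_n), P n E /\ blowup E h.
Proof.
move=> k0 hP nT far; apply: NNPP => no; apply: far.
exists (bounded_VC (m + m.+1)); split; first exact: bounded_VC_hereditary.
split; first exact: bounded_VC_finite.
move=> delta d0.
have [v0 hv0] := close_links k0.
(* The pullback is at distance at most 69/v, which must not exceed [delta]. *)
have [w hw] : exists w : nat, Rlt (Rdiv 69 delta) (INR w) by exact: INR_unbounded.
pose v := (v0 + w).+1.
have [|N hN] := @close_or_box k (m + m.+1) #|blowup_vert m s| v k0 isT.
  by apply: hv0; rewrite /v ltnW // ltnS leq_addr.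
exists N => n E PE /leP/leP Nn; have [[E' [E3 nVC hE']]|] := hN P n E nT PE Nn.
  exists E'; split=> //.
  have vd : Rle 69 (Rmult delta (INR v)).
    have : Rle (INR w) (INR v) by apply: INR_leq; rewrite /v ltnW // ltnS leq_addl.
    have := Rmult_lt_compat_r _ _ _ d0 hw; rewrite /Rdiv Rmult_assoc Rinv_l; last lra.
    by nra.
  have := INR_leq hE'; rewrite INR_mul [INR (69 * _)]INR_mul; move: (INR #|_|) (INR (n ^ 3)) (pos_INR (n ^ 3)) => x y y0 h.
  have v_gt0 : Rlt 0 (INR v) by apply: (lt_INR 0); apply/ltP.
  apply: (Rmult_le_reg_l (INR v)) => //; move: h; rewrite (_ : INR 69 = IZR 69); last by rewrite INR_IZR_INZ.
  by move: (Rmult_le_compat_r _ _ _ y0 vd); lra.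
case=> Lab [lab [good [R [w' [VCR wI hw']]]]]; case: no.
have [h hh] := box_blowup VCR wI hw'.
by exists n, E, h.
Qed.

(** * The lower bound *)

Section PartitionCounts.
Variables (T : finType) (Pt : {set {set T}}).
Hypothesis partPt : partition Pt [set: T].
Local Notation cls := (pblock Pt).

Lemma sum_card_parts : \sum_(X in Pt) #|X| = #|T|.
Proof. by rewrite -(card_partition partPt) cardsT. Qed.

Lemma mem_cls x : x \in cls x.
Proof. by rewrite mem_pblock (cover_partition partPt). Qed.

Lemma cls_in x : cls x \in Pt.
Proof. by apply: pblock_mem; rewrite (cover_partition partPt). Qed.

Lemma cls_eq X x : X \in Pt -> x \in X -> cls x = X.
Proof. by move=> XP xX; apply: def_pblock => //; case/and3P: partPt. Qed.

Lemma count_by_part (U : finType) (f : U -> T) (P : pred {set T}) :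
  #|[set a | P (cls (f a))]| = \sum_(X in Pt | P X) #|[set a | f a \in X]|.
Proof.
rewrite -sum1dep_card (partition_big (fun a => cls (f a)) (fun X => (X \in Pt) && P X)) /=.
  apply: eq_bigr => X /andP[XP PX]; rewrite -sum1dep_card; apply: eq_bigl => a.
  apply/andP/idP => [[_ /eqP <-]|aX]; first exact: mem_cls.
  by rewrite (cls_eq XP aX).
by move=> a Pa; rewrite cls_in.
Qed.

(** A part X in which the condition fails receives fewer than |X|/u points of [f], and the sizes of
    the parts add up to |T|. *)
Lemma sparse_count (U : finType) (f : U -> T) u :
  u * #|[set a | u * #|[set b | f b \in cls (f a)]| < #|cls (f a)|]| <= #|T|.
Proof.
rewrite (count_by_part f (fun X => u * #|[set b | f b \in X]| < #|X|)) big_distrr /=.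
rewrite -sum_card_parts [X in _ <= X]big_mkcond big_mkcondr /= [X in X <= _]big_mkcond.
by apply: leq_sum => X _; case: (X \in Pt) => //; case: ltnP => // /ltnW.
Qed.

Variables (h r : nat).
Local Notation m := (2 * h).
Local Notation code := ({set 'I_m} * 'I_r)%type.
Variables (g : code -> T) (u : nat).

Definition plus (Z : {set T}) i : {set code} := [set c : code | (g c \in Z) && (i \in c.1)].
Definition minus (Z : {set T}) i : {set code} := [set c : code | (g c \in Z) && (i \notin c.1)].
(** Both counts are compared with the whole part, not with the codes in it, because regularity
    speaks of subsets of proportional size. *)
Definition biased (Z : {set T}) : {set 'I_m} :=
  [set i | (u * #|plus Z i| < #|Z|) || (u * #|minus Z i| < #|Z|)].

Lemma card_trace (J K : {set 'I_m}) : #|[set S : {set 'I_m} | S :&: J == K]| <= 2 ^ (m - #|J|).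
Proof.
rewrite -(card_in_imset (f := fun S : {set 'I_m} => S :\: J)) => [|S S' ].
  have -> : m - #|J| = #|~: J| by have := cardsC J; rewrite card_ord; lia.
  rewrite -card_powerset; apply: subset_leq_card; apply/subsetP => _ /imsetP[S _ ->].
  by rewrite inE setDE subsetIr.
rewrite !inE => /eqP h1 /eqP h2 e; by rewrite -(setID S J) -(setID S' J) h1 h2 e.
Qed.

(* Outside the few codes disagreeing with a majority, Z determines h coordinates of a code. *)
Lemma biased_part_small Z : h <= #|biased Z| ->
  u * #|[set c | g c \in Z]| <= u * (2 ^ h * r) + m * #|Z|.
Proof.
move=> hJ; set J := biased Z.
(* [K] is the majority trace on [J]; if both sides are small at [i], [plus] is taken as the
   minority. *)
pose K := [set i in J | ~~ (u * #|plus Z i| < #|Z|)].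
pose minority i := if u * #|plus Z i| < #|Z| then plus Z i else minus Z i.
have sub : [set c | g c \in Z] \subset
    [set c : code | c.1 :&: J == K] :|: \bigcup_(i in J) minority i.
  apply/subsetP => c; rewrite inE => cZ; rewrite in_setU -[X in X || _]negbK -implybE.
  apply/implyP => ne; have [i] : exists i, (i \in c.1 :&: J) != (i \in K).
    apply/existsP; rewrite -negb_forall; apply: contra ne => /forallP e.
    by rewrite inE; apply/eqP/setP => i; apply/eqP; rewrite e.
  rewrite in_setI [i \in K]inE; case iJ: (i \in J); rewrite ?andbF ?andbT //= => ni.
  apply/bigcupP; exists i => //; rewrite /minority; move: ni.
  by case: ifP => _; rewrite !inE cZ; case: (i \in c.1).
have c1 : #|[set c : code | c.1 :&: J == K]| <= 2 ^ h * r.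
  rewrite (_ : [set c | _] = setX [set S | S :&: J == K] [set: 'I_r]); last first.
    by apply/setP => -[S t]; rewrite !inE andbT.
  rewrite cardsX cardsT card_ord leq_mul2r; apply/orP; right.
  apply: leq_trans (card_trace _ _) _; rewrite leq_exp2l // -/J; move: hJ; rewrite -/J.
  by move: (#|J|) => j; lia.
have c2 : u * #|\bigcup_(i in J) minority i| <= m * #|Z|.
  rewrite big_mkcond /=; apply: leq_trans (leq_mul (leqnn u) (card_bigcup_le _)) _.
  rewrite big_distrr /=; apply: sum_bounded_ord => i.
  case: ifP => [|_]; last by rewrite cards0 muln0.
  by rewrite inE /minority; case: ifP => [/ltnW//|_ /= /ltnW].
apply: leq_trans (leq_mul (leqnn u) (subset_leq_card sub)) _.
apply: leq_trans (leq_mul (leqnn u) (leq_card_setU _ _)) _.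
by rewrite mulnDr leq_add // leq_mul2l c1 orbT.
Qed.

Definition biased_codes : {set code} := [set c | h <= #|biased (cls (g c))|].

Lemma biased_codes_count :
  u * #|biased_codes| <= #|Pt| * (u * (2 ^ h * r)) + m * #|T|.
Proof.
rewrite /biased_codes (count_by_part g (fun Z => h <= #|biased Z|)) big_distrr /=.
rewrite -sum_card_parts big_distrr /= -sum_nat_const -big_split /=.
rewrite big_mkcondr; apply: leq_sum => Z _; case: ifP => // /biased_part_small; exact.
Qed.

Lemma unbiased_pairs_count : 2 * #|biased_codes| <= 2 ^ m * r ->
  h * (2 ^ m * r) <= 2 * \sum_(c : code) #|~: biased (cls (g c))|.
Proof.
move=> hb; have e : #|biased_codes| + #|~: biased_codes| = 2 ^ m * r.
  by rewrite cardsC card_prod card_set_type !card_ord.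
have h1 : #|~: biased_codes| * h <= \sum_(c : code) #|~: biased (cls (g c))|.
  apply: markov => c; rewrite !inE -ltnNge; have := cardsC (biased (cls (g c))).
  by rewrite card_ord; move: (#|_|) (#|~: _|) => a b; lia.
apply: leq_trans (leq_mul (leqnn 2) h1); rewrite [X in _ <= X]mulnA mulnC leq_mul2r; apply/orP; right.
by move: hb e; move: (#|biased_codes|) (#|~: _|) (2 ^ m * r) => a b c; lia.
Qed.

End PartitionCounts.

Section LowerBound.
Variables (h s u : nat) (T : finType) (E : {set {set T}}).
Local Notation m := (2 * h).
Local Notation L := (2 ^ m * s).
Local Notation n := (m * L).
Variables (f : blowup_vert m s -> T) (Pt : {set {set T}}) (Irr : {set T * T * T}).
Hypotheses (fE : blowup E f) (partPt : partition Pt [set: T]) (cardT : #|T| = 3 * n).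
Hypotheses (h0 : 0 < h) (s0 : 0 < s) (hu : 132 * m < u).
Hypothesis few_irr : u * #|Irr| <= #|T| ^ 3.
Local Notation cls := (pblock Pt).

Definition ptA i (t : 'I_L) : T := f (inl (inl (i, t))).
Definition ptB i (t : 'I_L) : T := f (inl (inr (i, t))).
Definition ptC (c : {set 'I_m} * 'I_(m * s)) : T := f (inr c).

Hypothesis split_irr : forall i t t' c,
  #|cls (ptA i t)| <= u * #|[set b | ptA i b \in cls (ptA i t)]| ->
  #|cls (ptB i t')| <= u * #|[set b | ptB i b \in cls (ptB i t')]| ->
  i \notin biased ptC u (cls (ptC c)) -> (ptA i t, ptB i t', ptC c) \in Irr.

(** With few parts there are at least m n L^2 / 4 tuples (i, t, t', c) such that i is unbiased for
    the part of c. Each has a sparse point in A_i, a sparse point in B_i, or a triple in [Irr]. As n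
    = m L, these account for at most 3, 3 and 27 times m^2 L^2 n / u, whence 132 = 4 * (3 + 3 +
    27). *)
Lemma blowup_parts : 2 ^ h < 4 * #|Pt|.
Proof.
rewrite ltnNge; apply/negP => Pth.
have n0 : 0 < n by rewrite !muln_gt0 h0 expn_gt0.
have cn : 2 ^ m * (m * s) = n by rewrite mulnCA.
have bc : 2 * #|biased_codes Pt ptC u| <= 2 ^ m * (m * s).
  have u0 : 0 < u by apply: leq_ltn_trans hu.
  have := biased_codes_count partPt ptC u; rewrite cardT => hb.
  have p2 : 4 * #|Pt| * (2 ^ h * (m * s)) <= 2 ^ m * (m * s).
    rewrite mulnA leq_mul2r; apply/orP; right.
    by rewrite mul2n -addnn expnD leq_mul2r Pth orbT.
  rewrite cn in p2 *; rewrite -(leq_pmul2l u0).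
  have h1 := leq_mul (leqnn u) p2; have h2 := leq_mul (ltnW hu) (leqnn n).
  move: hb h1 h2; move: (2 ^ h * (m * s)) => x.
  move: (#|biased_codes _ _ _|) (#|Pt|) (n) => a b c; clear; lia.
have K := unbiased_pairs_count partPt bc; set k := \sum_c _ in K; rewrite cn in K.
pose D : finType := ('I_m * 'I_L * 'I_L * ({set 'I_m} * 'I_(m * s)))%type.
pose badA i t := u * #|[set b | ptA i b \in cls (ptA i t)]| < #|cls (ptA i t)|.
pose badB i t := u * #|[set b | ptB i b \in cls (ptB i t)]| < #|cls (ptB i t)|.
pose G := [set d : D | d.1.1.1 \notin biased ptC u (cls (ptC d.2))].
pose GA := [set d : D | badA d.1.1.1 d.1.1.2]; pose GB := [set d : D | badB d.1.1.1 d.1.2].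
pose GI := [set d : D | (ptA d.1.1.1 d.1.1.2, ptB d.1.1.1 d.1.2, ptC d.2) \in Irr].
have sub : G \subset GA :|: GB :|: GI.
  apply/subsetP => -[[[i t] t'] c]; rewrite !inE /= => ni.
  by rewrite /badA /badB; case: ltnP => //= ha; case: ltnP => //= hb; apply: split_irr; rewrite ?inE.
have cC : #|{: {set 'I_m} * 'I_(m * s)}| = n by rewrite card_prod card_set_type !card_ord cn.
have eG : #|G| = L * L * k.
  rewrite (card_pairs (fun (p : 'I_m * 'I_L * 'I_L) c => p.1.1 \notin biased ptC u (cls (ptC c)))).
  rewrite double_count /k big_distrr /=; apply: eq_bigr => c _.
  rewrite (_ : [set x | _] = setX (setX (~: biased ptC u (cls (ptC c))) setT) setT).
    by rewrite !cardsX !cardsT !card_ord -mulnA mulnC.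
  by apply/setP => -[[i t] t']; rewrite !inE !andbT.
have cAB (bad : 'I_m -> 'I_L -> bool) : (forall i, u * #|[set t | bad i t]| <= #|T|) ->
    u * \sum_i #|[set t | bad i t]| <= m * (3 * n).
  by move=> hbad; rewrite big_distrr -cardT; apply: sum_bounded_ord.
pose box bad : {set D} := setX (setX [set p : 'I_m * 'I_L | bad p.1 p.2] setT) setT.
have cbox bad : (forall i, u * #|[set t | bad i t]| <= #|T|) -> u * #|box bad| <= m * (3 * n) * (L * n).
  move=> hbad; rewrite /box !cardsX !cardsT card_ord cC (card_pairs bad) -mulnA.
  by rewrite [X in X <= _]mulnA leq_mul2r cAB ?orbT.
have eA : u * #|GA| <= m * (3 * n) * (L * n).
  rewrite (_ : GA = box badA); last by apply/setP => -[[[i t] t'] c]; rewrite !inE !andbT.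
  by apply: cbox => i; apply: (sparse_count partPt (ptA i)).
have eB : u * #|GB| <= m * (3 * n) * (L * n).
  apply: leq_trans (cbox badB _); last by move=> i; apply: (sparse_count partPt (ptB i)).
  pose sw (d : D) : D := (d.1.1.1, d.1.2, d.1.1.2, d.2).
  rewrite leq_mul2l -(card_in_imset (f := sw)); last by move=> [[[i t] t'] c] [[[j r] r'] c'] _ _ [-> -> -> ->].
  apply/orP; right; apply: subset_leq_card; apply/subsetP => x /imsetP[d].
  by rewrite inE => hd ->; rewrite !inE hd.
have eI : #|GI| <= #|Irr|.
  pose em (d : D) := (ptA d.1.1.1 d.1.1.2, ptB d.1.1.1 d.1.2, ptC d.2).
  rewrite -(card_in_imset (f := em)); last first.
    move=> [[[i t] t'] c] [[[j r] r'] c'] _ _ [].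
    by rewrite /ptA /ptB /ptC /= => /(proj1 fE)[-> ->] /(proj1 fE)[->] /(proj1 fE)[->].
  by apply: subset_leq_card; apply/subsetP => x /imsetP[d]; rewrite inE => ? ->.
have := subset_leq_card sub; rewrite leqNgt => /negP; apply.
have hs : #|GA :|: GB :|: GI| <= #|GA| + #|GB| + #|Irr|.
  apply: leq_trans (leq_card_setU _ _) (leq_add _ eI); exact: leq_card_setU.
apply: leq_ltn_trans hs _; rewrite eG {eG}.
have L0 : 0 < L by rewrite muln_gt0 expn_gt0 s0.
have m0 : 0 < m by rewrite muln_gt0 h0.
have u0 : 0 < u by apply: leq_ltn_trans hu.
move: few_irr eA eB K hu; rewrite cardT.
move: (#|GA|) (#|GB|) (#|Irr|) (k) (L) L0 => a b c k' l l0.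
move=> hc ha hb hk hmu; rewrite -(ltn_pmul2l (m := 4 * u)); last by rewrite muln_gt0 u0.
have hk' : m * (m * l) <= 4 * k' by lia.
have key : 132 * m * (m * l * (m * (l * l))) < u * (m * l * (m * (l * l))).
  by rewrite ltn_pmul2r // !muln_gt0 h0 l0.
have hk2 := leq_mul (leqnn (u * (l * l))) hk'.
apply: leq_trans (_ : u * (m * l * (m * (l * l))) <= _); last by move: hk2; clear; lia.
apply: leq_ltn_trans key; move: hc ha hb; rewrite !expnS expn0.
move: (h) => x; clear; lia.
Qed.

End LowerBound.

(** * Both bounds as functions of epsilon *)

Section Reals.
Open Scope R_scope.


(** Inside X, Y and Z take the points of A_i, those of B_i, and the codes containing i, respectively
    missing i. The densities are 1 and 0, and they cannot both be within eps < 1/2 of the density of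
    (X, Y, Z). *)
Lemma blowup_reg_parts h s u (T : finType) (E : {set {set T}}) (f : blowup_vert (2 * h) s -> T) eps Pt :
  blowup E f -> #|T| = (3 * (2 * h * (2 ^ (2 * h) * s)))%N -> (0 < h)%N -> (0 < s)%N ->
  (132 * (2 * h) < u)%N -> 0 < eps -> INR u * eps <= 1 -> reg_partition E eps Pt ->
  (2 ^ h < 4 * #|Pt|)%N.
Proof.
move=> fE cT h0 s0 hu e0 ue [part [S [hS reg]]].
have u3 : INR 3 <= INR u by apply: INR_leq; move: hu h0; clear; lia.
have e12 : eps < 1 / 2 by rewrite /= in u3; nra.
apply: (blowup_parts (Irr := ~: S) fE part cT h0 s0 hu).
  apply: le_INR_nat; rewrite INR_mul; have := cardsC S.
  rewrite !card_prod (_ : (#|T| * #|T| * #|T|)%N = (#|T| ^ 3)%N); last first.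
    by rewrite !expnS expn0 muln1 mulnA.
  move: hS; move: (#|S|) (#|~: S|) (#|T| ^ 3)%N => a b N hS abN.
  have eN : INR N = INR a + INR b by rewrite -INR_add abN.
  have u0 := pos_INR u; have N0 := pos_INR N.
  have := Rmult_le_compat_r _ _ _ N0 ue; nra.
move=> i t t' c hA hB; rewrite inE => /norP[]; rewrite -!leqNgt => hp hm.
rewrite inE; apply/negP => /reg[X [Y [Z [[XP YP ZP] [[aX bY cZ] rXYZ]]]]].
move: hA hB hp hm; rewrite (cls_eq part XP aX) (cls_eq part YP bY) (cls_eq part ZP cZ) => hA hB hp hm.
have fI := proj1 fE.
have AI : injective (ptA f i) by move=> x y /fI[].
have BI : injective (ptB f i) by move=> x y /fI[].
have CI : injective (ptC f) by move=> x y /fI[].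
pose X' := ptA f i @: [set b | ptA f i b \in X]; pose Y' := ptB f i @: [set b | ptB f i b \in Y].
pose Zp := ptC f @: plus (ptC f) Z i; pose Zm := ptC f @: minus (ptC f) Z i.
have big (A A' : {set T}) : (#|A| <= u * #|A'|)%N -> eps * INR #|A| <= INR #|A'|.
  move/INR_leq; rewrite INR_mul => hl; have := pos_INR #|A'|.
  have := Rmult_le_compat_l _ _ _ (Rlt_le _ _ e0) hl; nra.
have ne (A A' : {set T}) x : x \in A -> (#|A| <= u * #|A'|)%N -> (0 < #|A'|)%N.
  move=> xA hl; have : (0 < #|A|)%N by apply/card_gt0P; exists x.
  by move: hl; case: (#|A'|) => //; rewrite muln0 leqn0 => /eqP->.
have cX : (#|X| <= u * #|X'|)%N by rewrite card_imset.
have cY : (#|Y| <= u * #|Y'|)%N by rewrite card_imset.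
have cp : (#|Z| <= u * #|Zp|)%N by rewrite card_imset.
have cm : (#|Z| <= u * #|Zm|)%N by rewrite card_imset.
have sX : X' \subset X by apply/subsetP => x /imsetP[b]; rewrite inE => ? ->.
have sY : Y' \subset Y by apply/subsetP => x /imsetP[b]; rewrite inE => ? ->.
have sp : Zp \subset Z by apply/subsetP => x /imsetP[b]; rewrite inE => /andP[? _] ->.
have sm : Zm \subset Z by apply/subsetP => x /imsetP[b]; rewrite inE => /andP[? _] ->.
have := rXYZ X' Y' Zp sX sY sp (big _ _ cX) (big _ _ cY) (big _ _ cp).
have := rXYZ X' Y' Zm sX sY sm (big _ _ cX) (big _ _ cY) (big _ _ cm).
have X0 := ne _ _ _ aX cX; have Y0 := ne _ _ _ bY cY.
have p0 := ne _ _ _ cZ cp; have m0 := ne _ _ _ cZ cm.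
have [_ hp'] := density_range E X0 Y0 p0; have [hm' _] := density_range E X0 Y0 m0.
have pos (A : {set T}) : (0 < #|A|)%N -> 0 < INR #|A| by move=> ?; apply: (lt_INR 0); apply/ltP.
have N0 (A : {set T}) : (0 < #|A|)%N -> 0 < INR (#|X'| * (#|Y'| * #|A|))%N.
  by move=> A0; rewrite !INR_mul; do 2! [apply: Rmult_lt_0_compat; first exact: pos]; apply: pos.
have Np := N0 _ p0; have Nm := N0 _ m0.
have ep : nonedges_in (edge E) X' Y' Zp = 0%N.
  apply: big1 => _ /imsetP[x _ ->]; apply: big1 => _ /imsetP[y _ ->]; apply: big1 => q /imsetP[[S' z]].
  by rewrite inE /= => /andP[_ iS] ->; rewrite (proj2 fE) iS.
have em : edges_in (edge E) X' Y' Zm = 0%N.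
  apply: big1 => _ /imsetP[x _ ->]; apply: big1 => _ /imsetP[y _ ->]; apply: big1 => q /imsetP[[S' z]].
  by rewrite inE /= => /andP[_ /negbTE iS] ->; rewrite (proj2 fE) iS.
rewrite ep /= in hp'; rewrite em /= in hm'.
have {}hm' : density E X' Y' Zm = 0 by case/esym/Rmult_integral: hm'; lra.
have {}hp' : density E X' Y' Zp = 1 by case/esym/Rmult_integral: hp'; lra.
by rewrite hm' hp'; move: (density E X Y Z) => d; split_Rabs; lra.
Qed.

Lemma nat_ceil r : 0 <= r -> exists w : nat, r < INR w <= r + 1.
Proof.
move=> r0; have [h1 h2] := archimed r.
have z0 : (0 <= up r)%Z.
  by apply: le_IZR; lra.
exists (Z.to_nat (up r)); rewrite INR_IZR_INZ Znat.Z2Nat.id //; lra.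
Qed.

Lemma ex_least (Q : nat -> Prop) M : Q M -> exists m, is_least Q m.
Proof.
elim/ltn_ind: M => M IH QM.
have [[m [Qm mM]]|no] := classic (exists m, Q m /\ (m < M)%N); first exact: IH mM Qm.
exists M; split=> // m' Qm'; rewrite leqNgt; apply/negP => lt; by apply: no; exists m'.
Qed.

Lemma INR_pow2 n : INR (2 ^ n)%N = Rpower 2 (INR n).
Proof. by rewrite INR_exp Rpower_pow //; lra. Qed.

(** The member containing the blow-up may have many other vertices; heredity cuts it down to the
    blow-up, whose size the choice s = N + 1 pushes above the threshold. *)
Lemma M_reg_lower k P M h u eps : (0 < k)%N -> hereditary P -> ~ in_Trip P (kUk k) ->
  far_from_finite_VC P -> (0 < h)%N -> (132 * (2 * h) < u)%N -> 0 < eps -> INR u * eps <= 1 ->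
  M_reg_ok P eps M -> (2 ^ h < 4 * M)%N.
Proof.
move=> k0 hP nT far h0 hu e0 ue [N hN].
have [n [E [f [PE [fI fE]]]]] := @far_blowup k P (2 * h)%N N.+1 k0 hP nT far.
pose D := blowup_vert (2 * h) N.+1.
pose g (i : 'I_#|D|) := f (enum_val i).
have gI : injective g by move=> i j /fI/enum_val_inj.
have cD : #|D| = (3 * (2 * h * (2 ^ (2 * h) * N.+1)))%N.
  rewrite /D !card_sum !card_prod card_set_type !card_ord.
  by move: (2 ^ _)%N => a; clear; nia.
have ND : (N <= #|D|)%N.
  rewrite cD; have : (0 < 2 ^ (2 * h))%N by rewrite expn_gt0.
  by move: (2 ^ _)%N h0 => a; clear; nia.
have [Pt [cPt reg]] := hN _ _ (proj2 hP _ _ g E gI PE) ND.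
have bl : blowup (induced g E) (fun d : D => enum_rank d).
  split; first exact: enum_rank_inj.
  move=> i t t' S c; rewrite -(fE i t t' S c) /edge inE !imsetU !imset_set1 /g.
  by rewrite !enum_rankK.
apply: leq_trans (blowup_reg_parts bl _ h0 _ hu e0 ue reg) _ => //.
  by rewrite card_ord.
by rewrite leq_mul2l.
Qed.

Lemma Rpower_inv_pow eps n : 0 < eps -> Rpower eps (- INR n) = (/ eps) ^ n.
Proof. by move=> e0; rewrite Rpower_Ropp Rpower_pow // pow_inv. Qed.

End Reals.

Open Scope R_scope.

Theorem theorem6p7 :
  forall k : nat, (1 <= k)%N ->
  exists C1 C2 : R, 0 < C1 /\ 0 < C2 /\
  forall P : prop3, hereditary P ->
    ~ in_Trip P (kUk k) ->
    far_from_finite_VC P ->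
    exists eps0 : R, 0 < eps0 /\
      forall eps : R, 0 < eps < eps0 ->
        exists m1 m2 : nat,
          is_least (M_reg_ok P eps) m1 /\
          is_least (M_hom_ok P (eps ^ 4 / 2)) m2 /\
          Rpower 2 (Rpower eps (- C1)) <= INR m1 /\
          (m1 <= m2)%N /\
          INR m2 <= Rpower 2 (Rpower 2 (Rpower eps (- C2))).
Proof.
move=> k k0; have [v0 hv0] := hom_bound k0; have [u0 hu0] := poly_le_exp 2 14.
(* The lower bound has order 2^(1/(265 eps)), so the exponent 1/2 leaves room for all constants.
   Above, the base [B] has order eps^-12, which eps^-13 absorbs. *)
exists (1 / 2), (INR 13); split; first lra; split; first by apply: (lt_INR 0); apply/ltP.
move=> P hP nT far; pose X0 := 1000000 + INR v0 + INR u0.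
have v0R := pos_INR v0; have u0R := pos_INR u0.
exists (/ X0); split; first by apply: Rinv_0_lt_compat; rewrite /X0; lra.
move=> eps [e0 eX]; pose x := / eps.
have xe : x * eps = 1 by rewrite /x Rinv_l //; lra.
have xX : X0 < x.
  by rewrite -(Rinv_inv X0); apply: Rinv_lt_contravar => //; apply: Rmult_lt_0_compat; lra.
have x1 : 1000000 < x by rewrite /X0 in xX; lra.
have x_pow n : 1 <= x ^ n by apply: pow_R1_Rle; lra.
have e1 : 0 < eps <= 1 by nra.
(* Precision eps^4/2 requires w >= 2 eps^-4. *)
have [w [w1 w2]] := @nat_ceil (2 * x ^ 4) ltac:(have := x_pow 4%N; lra).
pose B := (v0 + 87 * w ^ 3)%N; pose M := (2 ^ (B ^ 14)).+1.
have x4 : x <= x ^ 4.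
  by have -> : x ^ 4 = x * x ^ 3 by []; have := x_pow 3%N; nra.
have w_gt0 : (0 < w)%N.
  by apply/ltP/INR_lt; rewrite /=; have := x_pow 4%N; lra.
have Mok : M_hom_ok P (eps ^ 4 / 2) M.
  apply: hv0 => //.
  have xe4 : x ^ 4 * eps ^ 4 = 1 by rewrite -Rpow_mult_distr xe pow1.
  have e4 : 0 < eps ^ 4 by apply: pow_lt.
  by have := Rmult_lt_compat_r _ _ _ e4 w1; lra.
have [m2 [hm2 l2]] := ex_least Mok; have rm2 := M_hom_reg e1 hm2.
have [m1 [hm1 l1]] := ex_least rm2.
exists m1, m2; split=> //; split=> //; split; last split.
(* The choice u = 265 h just exceeds 132 * (2 * h) = 264 h, and h <= 1/(265 eps) keeps u * eps <=
   1. *)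
- have [h [hh1 hh2]] := @nat_ceil (x / 265 - 1) ltac:(lra).
  have h_gt0 : (0 < h)%N by apply/ltP/INR_lt; rewrite /=; lra.
  have lt := @M_reg_lower k P m1 h (265 * h)%N eps k0 hP nT far h_gt0
    ltac:(by move: h_gt0; clear; lia) e0 ltac:(rewrite INR_mul (_ : INR 265 = 265); last (by rewrite INR_IZR_INZ); nra) hm1.
  (* [y] is the square root of 1/eps; the 2 subtracted from [h] below is the factor 4 in 2^h < 4 *
     m1. *)
  pose y := Rpower eps (- (1 / 2)).
  have y0 : 0 < y by apply: exp_pos.
  have yy : y * y = x.
    rewrite -Rpower_plus (_ : - (1 / 2) + - (1 / 2) = - 1); last lra.
    by rewrite Rpower_Ropp Rpower_1.
  have y1000 : 1000 <= y by nra.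
  have yh : y <= INR h - 2 by nra.
  apply: Rle_trans (_ : Rpower 2 (INR h - 2) <= _); first by apply: Rle_Rpower; [lra | exact: yh].
  move: (INR_ltn lt); rewrite INR_mul INR_pow2 (_ : INR 4 = 4); last by rewrite INR_IZR_INZ.
  have -> : Rpower 2 (INR h) = Rpower 2 (INR h - 2) * 4.
    have -> : 4 = Rpower 2 (INR 2) by rewrite Rpower_pow /=; lra.
    by rewrite -Rpower_plus /=; congr Rpower; lra.
  lra.
- exact: l1.
apply: Rle_trans (INR_leq (l2 _ Mok)) _.
have Bu0 : (u0 <= B)%N.
  have wu : (u0 <= w)%N by apply: le_INR_nat; rewrite /X0 in xX; lra.
  apply: leq_trans wu _; rewrite /B; apply: leq_trans (leq_addl _ _).
  by rewrite !expnS expn0 muln1; move: w_gt0; clear; nia.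
have B_gt0 : (0 < B)%N by rewrite addn_gt0 muln_gt0 expn_gt0 w_gt0 orbT.
have MB : (M <= 2 ^ (2 ^ B))%N.
  apply: leq_trans (_ : (2 ^ (2 * B ^ 14) <= _)%N); last by rewrite leq_exp2l // hu0.
  rewrite mul2n -addnn expnD /M -[(2 ^ _).+1]addn1.
  have b0 : (0 < B ^ 14)%N by rewrite expn_gt0 B_gt0.
  have : (2 <= 2 ^ (B ^ 14))%N by rewrite -{1}[2%N]expn1 leq_exp2l.
  by move: (2 ^ _)%N => a; clear; nia.
apply: Rle_trans (INR_leq MB) _; rewrite !INR_pow2.
do 2! [apply: Rle_Rpower; first lra].
rewrite Rpower_inv_pow // -/x /B INR_add INR_mul INR_exp (_ : INR 87 = 87); last by rewrite INR_IZR_INZ.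
(* Since 87 * 27 = 2349, the sum v0 + 87 w^3 is absorbed by the one spare factor x > 1000000 + v0 +
   u0. *)
have w3 : INR w <= 3 * x ^ 4 by have := x_pow 4%N; lra.
have := pow_incr _ _ 3 (conj (pos_INR w) w3).
have -> : (3 * x ^ 4) ^ 3 = 27 * x ^ 12 by ring.
have -> : x ^ 13 = x * x ^ 12 by [].
have := x_pow 12%N; move: xX; rewrite /X0; move: (x ^ 12) => z xz z1 wz.
have h1 : (1000000 + INR v0 + INR u0) * z <= x * z by apply: Rmult_le_compat_r; lra.
have h2 : INR v0 <= INR v0 * z by nra.
have h3 : 0 <= INR u0 * z by apply: Rmult_le_pos; lra.
lra.
Qed.
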